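(* Assume that the index sets $G_1,\dots,G_g$ form a partition of $\{1,2,\dots,n\}$. Let $u\in\mathbb{R}^n$. Then the multifunction $\mathcal{M}:\mathbb{R}^n\rightrightarrows\mathbb{R}^{n\times n}$ defined in the context is a nonempty compact valued upper-semicontinuous multifunction, and every $M\in\mathcal{M}(u)$ is symmetric and positive semidefinite. Moreover, for any $M\in\mathcal{M}(w)$ with $w\to u$, $$\mathrm{Prox}_p(w)-\mathrm{Prox}_p(u)-M(w-u)=O(\|w-u\|^2).$$
   Context: $\lambda_1\ge0$, $\lambda_2\ge0$, $w_l>0$ for $l=1,\dots,g$, $\lambda_{2,l}:=\lambda_2w_l$; $x_{G_l}$ is the restriction of $x\in\mathbb{R}^n$ to the index set $G_l\subseteq\{1,\dots,n\}$; $\|\cdot\|$ is the Euclidean norm. The sparse group Lasso regularizer is $$p(x):=\varphi(x)+\phi(x),\qquad \varphi(x):=\lambda_1\|x\|_1,\qquad \phi(x):=\sum_{l=1}^g\lambda_{2,l}\|x_{G_l}\| .$$ For a closed proper convex function $q$, $\mathrm{Prox}_q(u):=\arg\min_x\{q(x)+\frac12\|x-u\|^2\}$. $\mathcal{P}_l:\mathbb{R}^n\to\mathbb{R}^{|G_l|}$ is the linear map $\mathcal{P}_lx=x_{G_l}$; $\mathcal{P}:=[\mathcal{P}_1;\dots;\mathcal{P}_g]:\mathbb{R}^n\to\mathbb{R}^{s}$, $s=\sum_l|G_l|$, with adjoint $\mathcal{P}^*$. $\mathcal{B}_2^{\lambda_{2,l}}:=\{u_l\in\mathbb{R}^{|G_l|}:\|u_l\|\le\lambda_{2,l}\}$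 and $\Pi_{\mathcal{B}_2^{\lambda_{2,l}}}$ is the Euclidean projection onto it. For a locally Lipschitz map $F$, $\partial F(\cdot)$ denotes the Clarke generalized Jacobian. The multifunction $\mathcal{M}$ is $$\mathcal{M}(u):=\left\{(I-\mathcal{P}^*\Sigma\mathcal{P})\Theta\ \middle|\ \Sigma=\mathrm{Diag}(\Sigma_1,\dots,\Sigma_g),\ \Sigma_l\in\partial\Pi_{\mathcal{B}_2^{\lambda_{2,l}}}(v_{G_l}),\ l=1,\dots,g,\ v=\mathrm{Prox}_\varphi(u),\ \Theta\in\partial\mathrm{Prox}_\varphi(u)\right\},$$ where $\mathrm{Diag}(\Sigma_1,\dots,\Sigma_g)$ is the block diagonal matrix. The final assertion means: for the given $u$ there are constants $C,\epsilon>0$ such that for all $w$ with $\|w-u\|\le\epsilon$ and all $M\in\mathcal{M}(w)$, $\|\mathrm{Prox}_p(w)-\mathrm{Prox}_p(u)-M(w-u)\|\le C\|w-u\|^2$. *)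

(* Defs.v *)
From HB Require Import structures.
From mathcomp Require Import all_boot all_order all_algebra.
From mathcomp Require Import all_classical all_reals all_analysis.
Import Order.TTheory GRing.Theory Num.Theory.
Import numFieldNormedType.Exports.

Set Implicit Arguments.
Unset Strict Implicit.
Unset Printing Implicit Defensive.

Local Open Scope classical_set_scope.
Local Open Scope ring_scope.

(* The canonical norm `|x| on matrices is the sup norm, hence the separate
   Euclidean norm. Limits, compactness, open sets and differentiability on
   'M[R]_(m, n) refer to the canonical (sup norm) structure; all norms being
   equivalent in finite dimension, this is the usual topology. *)
Definition enorm {R : realType} n (x : 'cV[R]_n) : R :=
  Num.sqrt (\sum_i x i 0 ^+ 2).

Definition l1norm {R : realType} n (x : 'cV[R]_n) : R := \sum_i `|x i 0|.

(* A choice of minimizer of f on A, with the junk value 0 if there is none. *)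
Definition argmin {R : realType} n (f : 'cV[R]_n -> R) (A : set 'cV[R]_n) :
    'cV[R]_n :=
  xget 0 [set x | A x /\ forall y, A y -> f x <= f y].

(* Only used for real-valued convex functions q. *)
Definition Prox {R : realType} n (q : 'cV[R]_n -> R) (u : 'cV[R]_n) :
    'cV[R]_n :=
  argmin (fun x => q x + 2^-1 * enorm (x - u) ^+ 2) setT.

Definition ball2 {R : realType} n (r : R) : set 'cV[R]_n :=
  [set x | enorm x <= r].

Definition proj {R : realType} n (A : set 'cV[R]_n) (u : 'cV[R]_n) :
    'cV[R]_n :=
  argmin (fun x => enorm (x - u)) A.

(* Unlike the library's jacobian, which acts on row vectors on the right, this
   is the usual matrix of partial derivatives: 'd F x v = jac F x *m v when F
   is differentiable at x. *)
Definition jac {R : realType} n m (F : 'cV[R]_n -> 'cV[R]_m) (x : 'cV[R]_n) :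
    'M[R]_(m, n) :=
  \matrix_(i, j) ('d F x (delta_mx j 0)) i 0.

Definition Bsubdiff {R : realType} n m (F : 'cV[R]_n -> 'cV[R]_m)
    (x : 'cV[R]_n) : set 'M[R]_(m, n) :=
  [set J | exists x_ : nat -> 'cV[R]_n,
    [/\ forall k, differentiable F (x_ k),
        x_ @ \oo --> x &
        (fun k => jac F (x_ k)) @ \oo --> J]].

Definition convex_hull {R : realType} (V : lmodType R) (A : set V) : set V :=
  smallest (@convex_set R V) A.

(* Clarke generalized Jacobian of a locally Lipschitz map. *)
Definition clarke {R : realType} n m (F : 'cV[R]_n -> 'cV[R]_m)
    (x : 'cV[R]_n) : set 'M[R]_(m, n) :=
  convex_hull (Bsubdiff F x).

Definition upper_semicontinuous_mf (X Y : topologicalType) (F : X -> set Y) :=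
  forall x (V : set Y), open V -> F x `<=` V -> \forall y \near x, F y `<=` V.

Definition possemidef {R : realType} n (M : 'M[R]_n) :=
  forall x : 'cV[R]_n, 0 <= (x^T *m M *m x) 0 0.

(* The blocks of a partition are nonempty, pairwise disjoint and cover the
   index set; injectivity says that distinct labels give distinct blocks. *)
Definition is_partition n g (G : 'I_g -> {set 'I_n}) :=
  injective G /\
  finset.partition [set G l | l in [set: 'I_g]]%SET [set: 'I_n]%SET.

(* x_A, with the coordinates taken in increasing order of the indices in A. *)
Definition restr {R : realType} n (A : {set 'I_n}) (x : 'cV[R]_n) :
    'cV[R]_#|A| :=
  rowsub (fun k : 'I_#|A| => enum_val k) x.

(* The matrix of restr A. *)
Definition Pblock {R : realType} n (A : {set 'I_n}) : 'M[R]_(#|A|, n) :=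
  rowsub (fun k : 'I_#|A| => enum_val k) 1%:M.

Definition Pmx {R : realType} n g (G : 'I_g -> {set 'I_n}) :
    'M[R]_(\sum_l #|G l|, n) :=
  \mxcol_l Pblock (G l).

Definition varphi {R : realType} n (lambda1 : R) (x : 'cV[R]_n) : R :=
  lambda1 * l1norm x.

Definition phi {R : realType} n g (lambda2 : R) (w : 'I_g -> R)
    (G : 'I_g -> {set 'I_n}) (x : 'cV[R]_n) : R :=
  \sum_l lambda2 * w l * enorm (restr (G l) x).

Definition sgl_reg {R : realType} n g (lambda1 lambda2 : R) (w : 'I_g -> R)
    (G : 'I_g -> {set 'I_n}) (x : 'cV[R]_n) : R :=
  varphi lambda1 x + phi lambda2 w G x.

Definition sgl_M {R : realType} n g (lambda1 lambda2 : R) (w : 'I_g -> R)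
    (G : 'I_g -> {set 'I_n}) (u : 'cV[R]_n) : set 'M[R]_n :=
  let v := Prox (varphi lambda1) u in
  [set M | exists (Sigma : forall l, 'M[R]_#|G l|) (Theta : 'M[R]_n),
    [/\ forall l,
          clarke (proj (ball2 (lambda2 * w l))) (restr (G l) v) (Sigma l),
        clarke (Prox (varphi lambda1)) u Theta &
        M = (1%:M - (Pmx G)^T *m (\mxdiag_l Sigma l) *m Pmx G) *m Theta]].

(* Main.v *)
Require Import Defs.
From mathcomp Require Import all_boot all_order all_algebra.
From mathcomp Require Import all_classical all_reals all_analysis.
From mathcomp Require Import ring lra.
Import Order.TTheory GRing.Theory Num.Theory.
Import numFieldNormedType.Exports.
Local Open Scope classical_set_scope.
Local Open Scope ring_scope.

Set Implicit Arguments.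
Unset Strict Implicit.
Unset Printing Implicit Defensive.

(** Everything rests on explicit formulas. The prox of lambda1 |.|_1 is the
    coordinatewise soft threshold, and the projection onto the ball of radius
    r is x |-> r / max(r, |x|) x. Both maps are smooth on either side of a
    kink (the set |x_i| = lambda1, resp. the sphere |x| = r), and both have a
    derivative that depends on the side through one number only, 0 on the
    inner side and 1 on the outer side (one such number per coordinate for the
    threshold). Their Clarke Jacobians are therefore obtained by letting that
    number range over [0, 1] on the kink (clarke_soft, clarke_bproj). The
    predicate switch records which values are allowed; it is a closed
    condition.

    Topology of the multifunction. By these formulas it is the image, under a
    jointly continuous map, of a set of parameters (t, theta) in a compact
    box, and this set depends on the point through a closed relation. Such a
    multifunction is compact valued and upper semicontinuous
    (compact_param_image, usc_param_image); it is nonempty because a switch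
    always has an admissible value.

    Symmetry and positivity. Put v = soft(u). If v_i <> 0 then theta_i = 1, so
    that Theta fixes v. Every element of the multifunction at u therefore
    simplifies to diag(d) + sum_l k_l z_l z_l^T with d, k >= 0, where z_l is v
    cut down to the group G_l (sgl_mx_decomposition).

    The estimate. Shrinking v by a nonnegative factor on each group keeps a
    subgradient of the l1 norm at v a subgradient at the shrunk vector. Hence
    the prox of the sum is the composition of the two proxes: it sends u to
    v - Pi(v), with Pi the blockwise projection (Prox_sgl). For w near u the
    threshold is exactly affine, soft(w) - soft(u) = Theta (w - u), for any
    Theta admissible at w (soft_near). The projection onto a ball of radius
    r > 0 satisfies |Pi(y) - Pi(x) - S (y - x)| <= 4/r |y - x|^2 for y near x
    and any S admissible at y (bproj_near). Nearness to x leaves only the case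
    where x and y lie on the same side of the sphere; there this is an explicit
    computation with x/|x| and y/|y| (bproj_err). Summing over the groups gives
    the result (sgl_estimate). *)

(** * Euclidean geometry and proximal points *)

Section Euclid.
Context {R : realType}.

Definition dotp n (x y : 'cV[R]_n) : R := \sum_i x i 0 * y i 0.

Lemma dotpE n (x y : 'cV[R]_n) : dotp x y = (x^T *m y) 0 0.
Proof. by rewrite mxE; apply: eq_bigr => i _; rewrite mxE. Qed.

Lemma dotpC n (x y : 'cV[R]_n) : dotp x y = dotp y x.
Proof. by apply: eq_bigr => i _; rewrite mulrC. Qed.

Lemma dotpDr n (x y z : 'cV[R]_n) : dotp x (y + z) = dotp x y + dotp x z.
Proof. by rewrite !dotpE mulmxDr mxE. Qed.

Lemma dotpZr n a (x y : 'cV[R]_n) : dotp x (a *: y) = a * dotp x y.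
Proof. by rewrite !dotpE -scalemxAr mxE. Qed.

Lemma dotpNr n (x y : 'cV[R]_n) : dotp x (- y) = - dotp x y.
Proof. by rewrite !dotpE mulmxN mxE. Qed.

Lemma dotpDl n (x y z : 'cV[R]_n) : dotp (y + z) x = dotp y x + dotp z x.
Proof. by rewrite dotpC dotpDr !(dotpC x). Qed.

Lemma dotpZl n a (x y : 'cV[R]_n) : dotp (a *: y) x = a * dotp y x.
Proof. by rewrite dotpC dotpZr (dotpC x). Qed.

Lemma dotpNl n (x y : 'cV[R]_n) : dotp (- y) x = - dotp y x.
Proof. by rewrite dotpC dotpNr (dotpC x). Qed.

Lemma dotp_suml n (I : finType) (F : I -> 'cV[R]_n) (x : 'cV[R]_n) :
  dotp (\sum_i F i) x = \sum_i dotp (F i) x.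
Proof.
by rewrite dotpE raddf_sum mulmx_suml summxE; apply: eq_bigr => i _;
  rewrite dotpE.
Qed.

Lemma dotp_trmx m n (A : 'M[R]_(m, n)) (x : 'cV[R]_m) (y : 'cV[R]_n) :
  dotp (A^T *m x) y = dotp x (A *m y).
Proof. by rewrite !dotpE trmx_mul trmxK mulmxA. Qed.

Lemma dotpxx_ge0 n (x : 'cV[R]_n) : 0 <= dotp x x.
Proof. by apply: sumr_ge0 => i _; rewrite -expr2 sqr_ge0. Qed.

Lemma sqr_enorm n (x : 'cV[R]_n) : enorm x ^+ 2 = dotp x x.
Proof.
rewrite /enorm sqr_sqrtr; last by apply: sumr_ge0 => i _; rewrite sqr_ge0.
by apply: eq_bigr => i _; rewrite expr2.
Qed.

Lemma enorm_ge0 n (x : 'cV[R]_n) : 0 <= enorm x.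
Proof. exact: sqrtr_ge0. Qed.

Lemma dotpxx_eq0 n (x : 'cV[R]_n) : dotp x x = 0 -> x = 0.
Proof.
move=> /eqP; rewrite psumr_eq0; last by move=> i _; rewrite -expr2 sqr_ge0.
move=> /allP x0; apply/colP => i; rewrite mxE; apply/eqP.
by have := x0 i (mem_index_enum _); rewrite -expr2 sqrf_eq0.
Qed.

Lemma enorm0 n : enorm (0 : 'cV[R]_n) = 0.
Proof.
by rewrite /enorm big1 ?sqrtr0 // => i _; rewrite mxE expr0n.
Qed.

Lemma enorm_eq0 n (x : 'cV[R]_n) : enorm x = 0 -> x = 0.
Proof. by move=> x0; apply: dotpxx_eq0; rewrite -sqr_enorm x0 expr0n. Qed.

Lemma sqr_enormD n (x y : 'cV[R]_n) :
  enorm (x + y) ^+ 2 = enorm x ^+ 2 + 2 * dotp x y + enorm y ^+ 2.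
Proof. by rewrite !sqr_enorm !(dotpDl, dotpDr) (dotpC y x); ring. Qed.

Lemma enormZ n a (x : 'cV[R]_n) : enorm (a *: x) = `|a| * enorm x.
Proof.
apply/eqP; rewrite -(@eqrXn2 _ 2) ?mulr_ge0 ?enorm_ge0 //.
by rewrite exprMn !sqr_enorm dotpZl dotpZr mulrA real_normK ?num_real // expr2.
Qed.

Lemma enormN n (x : 'cV[R]_n) : enorm (- x) = enorm x.
Proof. by rewrite -scaleN1r enormZ normrN1 mul1r. Qed.

Lemma dotp_le n (x y : 'cV[R]_n) : dotp x y <= enorm x * enorm y.
Proof.
have [y0|y0] := eqVneq (enorm y) 0.
  rewrite (enorm_eq0 y0) enorm0 mulr0.
  by rewrite -(scale0r (0 : 'cV_n)) dotpZr mul0r.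
apply: (@le_trans _ _ `|dotp x y|); first exact: ler_norm.
rewrite -(@ler_pXn2r _ 2) ?nnegrE ?mulr_ge0 ?enorm_ge0 //.
rewrite real_normK ?num_real // exprMn.
have := sqr_ge0 (enorm (enorm y ^+ 2 *: x - dotp x y *: y)).
rewrite sqr_enormD enormN !enormZ dotpNr dotpZl dotpZr !exprMn.
rewrite !real_normK ?num_real // => h.
have y2 : 0 < enorm y ^+ 2 by rewrite exprn_gt0 // lt0r y0 enorm_ge0.
rewrite -subr_ge0 -(pmulr_rge0 _ y2).
by apply: le_trans h _; rewrite le_eqVlt; apply/orP; left; apply/eqP; ring.
Qed.

Lemma enormD n (x y : 'cV[R]_n) : enorm (x + y) <= enorm x + enorm y.
Proof.
rewrite -(@ler_pXn2r _ 2) ?nnegrE ?addr_ge0 ?enorm_ge0 //.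
rewrite sqr_enormD; have := dotp_le x y; nra.
Qed.

Lemma enorm_sum n (I : finType) (F : I -> 'cV[R]_n) :
  enorm (\sum_i F i) <= \sum_i enorm (F i).
Proof.
elim/big_ind2: _ => [|x a y b xa yb|//]; first by rewrite enorm0.
exact: le_trans (enormD _ _) (lerD xa yb).
Qed.

Lemma ler_dist_enorm n (x y : 'cV[R]_n) :
  `|enorm x - enorm y| <= enorm (x - y).
Proof.
have tri (a b : 'cV[R]_n) : enorm a - enorm b <= enorm (a - b).
  by rewrite lerBlDr -{1}(subrK b a) enormD.
by rewrite ler_norml tri andbT lerNl opprB -(enormN (x - y)) opprB tri.
Qed.

Lemma normr_coord_enorm n (x : 'cV[R]_n) i : `|x i 0| <= enorm x.
Proof.
rewrite -(@ler_pXn2r _ 2) ?nnegrE ?enorm_ge0 //.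
rewrite sqr_enorm real_normK ?num_real // /dotp (bigD1 i) //= -expr2 lerDl.
by apply: sumr_ge0 => j _; rewrite -expr2 sqr_ge0.
Qed.

Lemma normr_coord m n (x : 'M[R]_(m, n)) i j : `|x i j| <= `|x|.
Proof.
rewrite [leRHS]/Num.norm /= mx_normrE.
by apply/bigmax_geP; right => /=; exists (i, j).
Qed.

Lemma normr_le_enorm n (x : 'cV[R]_n) : `|x| <= enorm x.
Proof.
rewrite [leLHS]/Num.norm /= mx_normrE; apply/bigmax_leP.
split=> [|[i j] _] /=; first exact: enorm_ge0.
by rewrite ord1 normr_coord_enorm.
Qed.

Lemma enorm_le_l1 n (x : 'cV[R]_n) : enorm x <= \sum_i `|x i 0|.
Proof.
rewrite -(@ler_pXn2r _ 2) ?nnegrE ?enorm_ge0 ?sumr_ge0 //.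
rewrite sqr_enorm expr2 mulr_suml; apply: ler_sum => i _.
rewrite (le_trans (ler_norm _)) // normrM ler_wpM2l //.
by rewrite (bigD1 i) //= lerDl sumr_ge0.
Qed.

Lemma enorm_le_normr n (x : 'cV[R]_n) : enorm x <= n%:R * `|x|.
Proof.
apply: (le_trans (enorm_le_l1 x)).
apply: (@le_trans _ _ (\sum_(i < n) `|x|)).
  by apply: ler_sum => i _; exact: normr_coord.
by rewrite sumr_const card_ord mulr_natl.
Qed.

Lemma argmin_eq n (f : 'cV[R]_n -> R) (A : set 'cV[R]_n) x :
  A x -> (forall y, A y -> f y <= f x -> y = x) -> argmin f A = x.
Proof.
move=> Ax fx; apply: xget_unique.
  split=> // y Ay; have [//|yx] := leP (f x) (f y).
  by move: (yx); rewrite (fx y Ay (ltW yx)) ltxx.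
by move=> y [Ay /(_ _ Ax) yx]; exact: fx.
Qed.

(** If u - x is a subgradient of q at x, then the objective at y exceeds the
    objective at x by at least |y - x|^2 / 2, so x is the only minimizer. *)
Lemma Prox_subgradient n (q : 'cV[R]_n -> R) u x :
  (forall y, q x + dotp (u - x) (y - x) <= q y) -> Prox q u = x.
Proof.
move=> qx; apply: argmin_eq => // y _ h; apply/subr0_eq/enorm_eq0.
apply/eqP; rewrite -sqrf_eq0; apply/eqP/le_anti; rewrite sqr_ge0 andbT.
have := qx y; have := sqr_enormD (y - x) (x - u).
rewrite addrA subrK -(opprB u x) dotpNr enormN -[in enorm (u - x)]opprB enormN.
rewrite (dotpC (y - x)).
set a := dotp _ _; lra.
Qed.

End Euclid.

(** * Matrix-valued maps: continuity, differentials, Clarke Jacobians *)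

Section Topology.
Context {R : realType}.

Lemma cvg_mx (T : Type) (F : set_system T) (FF : Filter F) m n
    (f : T -> 'M[R]_(m, n)) (M : 'M[R]_(m, n)) :
  (forall i j, (fun t => f t i j) @ F --> M i j) -> f @ F --> M.
Proof.
move=> fM B [P MP sPB].
have : \forall t \near F, forall i j, P i j (f t i j).
  by apply: filter_forall => i; apply: filter_forall => j; exact: fM (MP i j).
by apply: filterS => t Pt; exact: sPB.
Qed.

Lemma mx_continuous (T : topologicalType) m n (f : T -> 'M[R]_(m, n)) :
  (forall i j, continuous (fun t => f t i j)) -> continuous f.
Proof. by move=> fc t; apply: cvg_mx => i j; exact: fc. Qed.

Lemma continuous_bigsum (T : topologicalType) (I : finType) (f : I -> T -> R) :
  (forall i, continuous (f i)) -> continuous (fun t => \sum_i f i t).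
Proof.
move=> fc; have : forall s : seq I, continuous (fun t => \sum_(i <- s) f i t).
  elim=> [|i s IHs] t.
    rewrite (_ : (fun _ => _) = cst 0); first exact: cvg_cst.
    by apply/funext => x; rewrite big_nil.
  rewrite (_ : (fun _ => _) = fun x => f i x + \sum_(j <- s) f j x); last first.
    by apply/funext => x; rewrite big_cons.
  by apply: continuousD; [exact: fc | exact: IHs].
exact.
Qed.

Lemma continuous_mulr (T : topologicalType) (f h : T -> R) :
  continuous f -> continuous h -> continuous (fun t => f t * h t).
Proof. by move=> fc hc t; apply: continuousM; [exact: fc | exact: hc]. Qed.

Lemma continuous_coord (T : topologicalType) m n (f : T -> 'M[R]_(m, n)) i j :
  continuous f -> continuous (fun t => f t i j).
Proof.
move=> fc t; apply: (@continuous_comp _ _ _ f (fun M : 'M[R]_(m, n) => M i j)).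
  exact: fc.
exact: coord_continuous.
Qed.

Lemma mulmx_continuous m n (A : 'M[R]_(m, n)) :
  continuous (mulmx A : 'cV[R]_n -> 'cV[R]_m).
Proof.
apply: mx_continuous => i j x.
rewrite (_ : (fun t : 'cV[R]_n => (A *m t) i j) =
    fun t => \sum_k A i k * t k j); last by apply/funext => t; rewrite mxE.
apply: continuous_bigsum => k y.
by apply: continuousM; [exact: cst_continuous | exact: coord_continuous].
Qed.

(** Neighbourhoods refer to the sup norm; this is the passage to a Euclidean
    ball. *)
Lemma near_enorm n (u : 'cV[R]_n) (P : set 'cV[R]_n) :
  (\forall x \near u, P x) ->
  exists2 e : R, 0 < e & forall x, enorm (x - u) <= e -> P x.
Proof.
move=> /nbhs_ballP[e /= e0 eP]; exists (e / 2); first by rewrite divr_gt0.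
move=> x xu; apply: eP; rewrite -ball_normE /= distrC.
apply: le_lt_trans (normr_le_enorm _) _; apply: le_lt_trans xu _.
by rewrite gtr_pMr // invf_lt1 // ltr1n.
Qed.

End Topology.

Lemma enorm_continuous (R : realType) n : continuous (@enorm R n).
Proof.
move=> x; apply/(@cvgrPdist_le _ _ _ (nbhs x)) => e e0.
have ne : 0 < e / (n%:R + 1) by rewrite divr_gt0 // ltr_wpDl.
have : \forall y \near x, `|x - y| <= e / (n%:R + 1).
  apply/nbhs_ballP; exists (e / (n%:R + 1)) => //= y.
  by rewrite -ball_normE /= => /ltW.
apply: (@filterS _ (nbhs x)) => y xy.
apply: (@le_trans _ _ (enorm (x - y))).
  exact: ler_dist_enorm.
apply: le_trans (enorm_le_normr _) _.
rewrite ler_pdivlMr ?ltr_wpDl // in xy.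
by apply: le_trans xy; rewrite mulrC ler_wpM2l // lerDl.
Qed.

Section Differentials.
Context {R : realType} {m n : nat}.
Implicit Types (F : 'cV[R]_n -> 'cV[R]_m) (A : 'M[R]_(m, n)).

(** A quadratic remainder in the Euclidean norm is a little-o in the sup norm,
    the two norms differing by a factor of at most n. *)
Lemma differentiable_quadratic F x A C :
  (\forall y \near x,
     enorm (F y - F x - A *m (y - x)) <= C * enorm (y - x) ^+ 2) ->
  differentiable F x /\ 'd F x = mulmx A :> (_ -> _).
Proof.
move=> FA; have Ac := @mulmx_continuous R m n A.
have E : F \o shift x = cst (F x) + mulmx A +o_ (0 : 'cV[R]_n) id.
  apply/eqaddoP => e e0.
  have FA0 : \forall h \near (0 : 'cV[R]_n),
      enorm (F (h + x) - F x - A *m h) <= C * enorm h ^+ 2.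
    move: FA; rewrite (near_shift 0); apply: filterS => h /=.
    by rewrite subr0 addrK.
  pose k := `|C| * n%:R ^+ 2 + 1.
  have k0 : 0 < k by rewrite ltr_wpDl // mulr_ge0 // exprn_ge0.
  have : \forall h \near (0 : 'cV[R]_n), `|h| <= e / k.
    by apply: nbhs0_le; rewrite divr_gt0.
  apply: filterS2 FA0 => h hA hk.
  have -> : ((F \o shift x) - (cst (F x) + mulmx A)) h =
      F (h + x) - F x - A *m h.
    by rewrite -[LHS]/(_ - (_ + _)) opprD addrA.
  apply: le_trans (normr_le_enorm _) _; apply: le_trans hA _.
  apply: (@le_trans _ _ (k * (`|h| * `|h|))); last first.
    by rewrite mulrA ler_wpM2r // mulrC -ler_pdivlMr.
  apply: (@le_trans _ _ (`|C| * (n%:R * `|h|) ^+ 2)).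
    apply: (@le_trans _ _ (`|C| * enorm h ^+ 2)).
      by rewrite ler_wpM2r ?sqr_ge0 // ler_norm.
    by rewrite ler_wpM2l // ler_pXn2r ?nnegrE ?mulr_ge0 ?enorm_ge0 //
      enorm_le_normr.
  by rewrite exprMn -expr2 mulrA ler_wpM2r ?sqr_ge0 // lerDl.
have dE := diff_unique Ac E.
split=> //; apply/diff_locallyP; rewrite dE; split=> //.
Qed.

(** Once differentiability is known, a one-sided expansion along v is enough
    to identify the differential at v. At a kink this reads off the derivative
    from a half-line that stays on one side. *)
Lemma diff_direction F x v d C :
  differentiable F x ->
  (\forall h \near 0^'+, enorm (F (x + h *: v) - F x - h *: d) <= C * h ^+ 2) ->
  'd F x v = d.
Proof.
move=> Fx Fd; pose g (h : R) := h^-1 *: (F (h *: v + x) - F x).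
have gd : g h @[h --> 0^'] --> 'd F x v.
  by rewrite -deriveE //; exact: (diff_derivable Fx).
have {}gd := cvg_dnbhs_at_right gd.
apply: (cvg_unique (@norm_hausdorff _ _) gd).
apply/cvgrPdist_le => e e0.
pose k := `|C| + 1; have k0 : 0 < k by rewrite ltr_wpDl.
have hk : \forall h \near 0^'+, h <= e / k.
  by apply: nbhs_right_le; rewrite divr_gt0.
near=> h; have h0 : 0 < h by near: h; exact: nbhs_right_gt.
have -> : d - g h = - (h^-1 *: (F (x + h *: v) - F x - h *: d)).
  by rewrite /g (addrC x) [in RHS]scalerBr scalerK ?gt_eqF // opprB.
rewrite normrN normrZ gtr0_norm ?invr_gt0 // ler_pdivrMl //.
apply: le_trans (normr_le_enorm _) _.
apply: (@le_trans _ _ (C * h ^+ 2)); first by near: h.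
rewrite expr2 mulrCA ler_pM2l //.
apply: (@le_trans _ _ (k * h)).
  by rewrite ler_pM2r // (le_trans (ler_norm _)) // lerDl.
by rewrite mulrC -ler_pdivlMr //; near: h.
Unshelve. all: by end_near. Qed.

Lemma jac_eq F x A : (forall j, 'd F x (delta_mx j 0) = A *m delta_mx j 0) ->
  jac F x = A.
Proof.
by move=> dF; apply/matrixP => i j; rewrite mxE dF -colE mxE.
Qed.

End Differentials.

Section Clarke.
Context {R : realType} {m n : nat}.
Implicit Types (F : 'cV[R]_n -> 'cV[R]_m).

(** The convex hull is an intersection of convex sets, hence convex. *)
Lemma clarke_segment F x J1 J2 t : clarke F x J1 -> clarke F x J2 ->
  0 <= t <= 1 -> clarke F x (t *: J1 + (1 - t) *: J2).
Proof.
move=> cJ1 cJ2 /andP[t0 t1] B [cB FB].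
have := cB J1 J2 (Itv01 t0 t1).
rewrite !inE => /(_ (cJ1 _ (conj cB FB)) (cJ2 _ (conj cB FB))).
by [].
Qed.

(** How elements of the B-subdifferential are produced: the Jacobians along
    the sequence are recognized from quadratic expansions. *)
Lemma Bsubdiff_limit F x J (y_ : nat -> 'cV[R]_n) (A_ : nat -> 'M[R]_(m, n))
    (C_ : nat -> R) :
  (forall k, \forall z \near y_ k,
     enorm (F z - F (y_ k) - A_ k *m (z - y_ k)) <= C_ k * enorm (z - y_ k) ^+ 2) ->
  y_ @ \oo --> x -> A_ @ \oo --> J -> Bsubdiff F x J.
Proof.
move=> FA yx AJ; exists y_; split=> //.
  by move=> k; have [] := differentiable_quadratic (FA k).
rewrite (_ : (fun k => jac F (y_ k)) = A_) //; apply/funext => k.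
by apply: jac_eq => j; have [_ ->] := differentiable_quadratic (FA k).
Qed.

Lemma Bsubdiff_clarke F x : Bsubdiff F x `<=` clarke F x.
Proof. exact: sub_smallest. Qed.

(** How elements of the B-subdifferential are bounded: a closed relation that
    contains all Jacobians also contains their limits. *)
Lemma Bsubdiff_sub F x (V : 'cV[R]_n -> set 'M[R]_(m, n)) :
  (forall y, differentiable F y -> V y (jac F y)) ->
  closed [set yJ : 'cV[R]_n * 'M[R]_(m, n) | V yJ.1 yJ.2] ->
  Bsubdiff F x `<=` V x.
Proof.
move=> FV cV J [y_ [Fy yx yJ]].
have yJx : (y_ k, jac F (y_ k)) @[k --> \oo] --> (x, J) by exact: (cvg_pair yx yJ).
have := @closed_cvg _ _ \oo _ _ _ cV _ (x, J) yJx; apply.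
by apply: nearW => k /=; exact: FV.
Qed.

Lemma clarke_sub F x (T : set 'M[R]_(m, n)) :
  Bsubdiff F x `<=` T ->
  (forall J1 J2 t, T J1 -> T J2 -> 0 <= t <= 1 -> T (t *: J1 + (1 - t) *: J2)) ->
  clarke F x `<=` T.
Proof.
move=> FT convT J; apply; split=> //.
move=> J1 J2 t /set_mem T1 /set_mem T2; apply/mem_set.
by apply: convT => //; apply/andP; split.
Qed.

End Clarke.

(** * The switch between the two sides of a kink *)

Section Switch.
Context {R : realType}.

(** th is an admissible slope at a point whose size is a, for a kink at lam:
    0 below lam, 1 above lam, anything in [0, 1] at lam. When lam = 0 there is
    no inner side, and the last clause forces th = 1. *)
Definition switch (lam a th : R) :=
  [&& 0 <= th <= 1, (lam <= a) || (th == 0), (a <= lam) || (th == 1)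
    & (0 < lam) || (th == 1)].

Lemma switchP lam a th : switch lam a th ->
  [\/ th = 0 /\ 0 < lam /\ a <= lam, th = 1 /\ lam <= a
    | [/\ 0 < lam, a = lam & 0 <= th <= 1]].
Proof.
move=> /and4P[th01 /orP[la|/eqP t0] /orP[al|/eqP t1] /orP[l0|/eqP t1']].
- by apply: Or33; split=> //; apply/le_anti/andP.
- by apply: Or32.
- by apply: Or32.
- by apply: Or32.
- by apply: Or31.
- by move: t1'; rewrite t0 => /esym/eqP; rewrite oner_eq0.
- by move: t1; rewrite t0 => /esym/eqP; rewrite oner_eq0.
- by move: t1; rewrite t0 => /esym/eqP; rewrite oner_eq0.
Qed.

Lemma switch0 lam a : 0 < lam -> a <= lam -> switch lam a 0.
Proof. by move=> l0 al; rewrite /switch l0 al eqxx lexx ler01 orbT. Qed.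

Lemma switch1 lam a : lam <= a -> switch lam a 1.
Proof. by move=> la; rewrite /switch la eqxx lexx ler01 !orbT. Qed.

(** With a slope equal to 0 or 1, two admissible points lie on the same closed
    side of the kink. *)
Lemma switch_side lam a b th : switch lam a th -> switch lam b th ->
  (th = 0 \/ th = 1) ->
  [/\ th = 0, a <= lam & b <= lam] \/ [/\ th = 1, lam <= a & lam <= b].
Proof.
move=> sa sb [] th01; rewrite th01 in sa sb *.
  left; split=> //.
    by case/switchP: sa => [[_ []]//|[/eqP]|[_ -> _]//]; rewrite eq_sym oner_eq0.
  by case/switchP: sb => [[_ []]//|[/eqP]|[_ -> _]//]; rewrite eq_sym oner_eq0.
right; split=> //.
  by case/switchP: sa => [[/eqP]|[]//|[_ -> _]//]; rewrite oner_eq0.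
by case/switchP: sb => [[/eqP]|[]//|[_ -> _]//]; rewrite oner_eq0.
Qed.

Lemma switch_ex lam a : 0 <= a -> exists th, switch lam a th.
Proof.
move=> a0; have [la|al] := leP lam a; first by exists 1; exact: switch1.
by exists 0; apply: switch0 (ltW al); exact: le_lt_trans al.
Qed.

Lemma switch_convex lam a th1 th2 t : switch lam a th1 -> switch lam a th2 ->
  0 <= t <= 1 -> switch lam a (t * th1 + (1 - t) * th2).
Proof.
move=> /and4P[/andP[? ?] h1 h2 h3] /and4P[/andP[? ?] g1 g2 g3] /andP[t0 t1].
apply/and4P; split.
- by apply/andP; split; nra.
- case/orP: h1 => [->//|/eqP->]; case/orP: g1 => [->//|/eqP->].
  by rewrite !mulr0 addr0 eqxx orbT.
- case/orP: h2 => [->//|/eqP->]; case/orP: g2 => [->//|/eqP->].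
  by rewrite !mulr1 addrC subrK eqxx orbT.
- case/orP: h3 => [->//|/eqP->]; case/orP: g3 => [->//|/eqP->].
  by rewrite !mulr1 addrC subrK eqxx orbT.
Qed.

Lemma closed_switch lam (T : topologicalType) (a th : T -> R) :
  continuous a -> continuous th -> closed [set x | switch lam (a x) (th x)].
Proof.
move=> ac thc.
have cl (f : T -> R) (D : set R) : continuous f -> closed D ->
    closed [set x | D (f x)].
  by move=> fc cD; apply: (@preimage_closed _ _ f D _ cD) => x _; exact: fc.
rewrite (_ : [set x | _] =
  ([set x | 0 <= th x] `&` [set x | th x <= 1]) `&`
  (([set x | lam <= a x] `|` [set x | th x = 0]) `&`
  (([set x | a x <= lam] `|` [set x | th x = 1]) `&`
   ([set x | 0 < lam] `|` [set x | th x = 1])))).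
  apply: closedI; first by apply: closedI;
    [exact: (cl th _ thc (@closed_ge _ 0))|exact: (cl th _ thc (@closed_le _ 1))].
  apply: closedI; first by apply: closedU;
    [exact: (cl a _ ac (@closed_ge _ lam))|exact: (cl th _ thc (@closed_eq _ 0))].
  apply: closedI; first by apply: closedU;
    [exact: (cl a _ ac (@closed_le _ lam))|exact: (cl th _ thc (@closed_eq _ 1))].
  apply: closedU; last exact: (cl th _ thc (@closed_eq _ 1)).
  have [l0|l0] := boolP (0 < lam).
    rewrite (_ : mkset _ = setT); first exact: closedT.
    by apply/seteqP; split.
  rewrite (_ : mkset _ = set0); first exact: closed0.
  by apply/seteqP; split.
have orE (P : bool) (y z : R) : P || (y == z) <-> P \/ y = z.
  by split=> [/orP[|/eqP]|[->//|->]]; [left|right|rewrite eqxx orbT].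
apply/seteqP; split=> x /=.
  by move=> /and4P[/andP[? ?] /orE ? /orE ? /orE ?].
by move=> [[? ?] [? [? ?]]]; apply/and4P; split; [exact/andP| | |]; exact/orE.
Qed.

(** Away from the kink an admissible slope stays admissible nearby. Sizes are
    nonnegative, hence the restriction to b >= 0. *)
Lemma switch_stable lam a th : (th = 0 \/ th = 1) -> switch lam a th ->
  (a = lam -> lam = 0) -> 0 <= a -> 0 <= lam ->
  \forall b \near a, 0 <= b -> switch lam b th.
Proof.
move=> th01 sw alam a0 l0.
have [al|la|al] := ltgtP a lam.
- have : \forall b \near a, b < lam by exact: lt_nbhsl.
  apply: (@filterS _ (nbhs a)) => b bl b0.
  case/switchP: sw => [[-> [? _]]|[_ ?]|[_ ? _]]; last 2 first.
    lra.
    lra.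
  exact: switch0 (ltW bl).
- have : \forall b \near a, lam < b by exact: lt_nbhsr.
  apply: (@filterS _ (nbhs a)) => b lb b0.
  case/switchP: sw => [[_ [? ?]]|[-> _]|[_ ? _]].
  + lra.
  + exact: switch1 (ltW lb).
  + lra.
- apply: (@nearW _ (nbhs a)) => b b0.
  case/switchP: sw => [[_ [? _]]|[-> _]|[? _ _]].
  + by have := alam al; lra.
  + by apply: switch1; rewrite (alam al).
  + by have := alam al; lra.
Qed.

(** A factor tending to 1 as k grows. On the kink it pushes a to the side on
    which th is the slope: outwards if th = 1, inwards otherwise. *)
Definition unkink (lam a th : R) (k : nat) : R :=
  if a == lam then (if th == 1 then 1 + k.+1%:R^-1 else 1 - k.+1%:R^-1) else 1.

Lemma unkink_cvg lam a th : unkink lam a th @ \oo --> (1 : R).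
Proof.
have h : (k.+1%:R^-1 : R) @[k --> \oo] --> (0 : R) by exact: cvg_harmonic.
rewrite /unkink; case: eqP => _; last exact: cvg_cst.
case: eqP => _.
  by rewrite -[X in _ --> X]addr0; apply: cvgD => //; exact: cvg_cst.
by rewrite -[X in _ --> X]subr0; apply: cvgB => //; exact: cvg_cst.
Qed.

Lemma unkink_ge0 lam a th k : 0 <= unkink lam a th k.
Proof.
have : 0 <= (k.+1%:R : R)^-1 by rewrite invr_ge0.
have : (k.+1%:R : R)^-1 <= 1 by rewrite invf_le1 // ler1n.
by rewrite /unkink; move: (_^-1) => i ? ?; case: ifP => _; [case: ifP => _|]; lra.
Qed.

Lemma unkink_switch lam a th k : 0 <= a -> 0 <= lam -> (th = 0 \/ th = 1) ->
  switch lam a th ->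
  \forall b \near (unkink lam a th k * a), 0 <= b -> switch lam b th.
Proof.
move=> a0 l0 th01 sw.
have k0 : 0 < (k.+1%:R : R)^-1 by rewrite invr_gt0.
apply: switch_stable => //; last by rewrite mulr_ge0 ?unkink_ge0.
  rewrite /unkink; move: (_^-1) k0 => i i0.
  have [al|_] := eqVneq a lam; last by rewrite mul1r.
  case/switchP: sw => [[-> [? _]]|[-> _]|[? _ _]].
  - by rewrite eq_sym oner_eq0; apply: switch0 => //; rewrite al; nra.
  - by rewrite eqxx; apply: switch1; rewrite al; nra.
  - case: th01 => ->; first by
      rewrite eq_sym oner_eq0; apply: switch0 => //; rewrite al; nra.
    by rewrite eqxx; apply: switch1; rewrite al; nra.
rewrite /unkink; move: (_^-1) k0 => i i0; have [al|al] := eqVneq a lam; last first.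
  by rewrite mul1r => h; rewrite h eqxx in al.
by case: ifP => _; rewrite al; nra.
Qed.

End Switch.

(** * The soft threshold *)

Section Soft.
Context {R : realType} (lam : R).

(** For lam >= 0: a - lam above lam, a + lam below - lam, and 0 in between;
    this form makes continuity evident. *)
Definition soft_thr (a : R) : R := Num.max (a - lam) 0 + Num.min (a + lam) 0.

Lemma soft_thrP a : 0 <= lam ->
  [\/ lam <= a /\ soft_thr a = a - lam, a <= - lam /\ soft_thr a = a + lam
    | - lam <= a <= lam /\ soft_thr a = 0].
Proof.
move=> lam0; rewrite /soft_thr.
case: (ltP (a - lam) 0) => h1; case: (ltP (a + lam) 0) => h2.
- by apply: Or32; split; lra.
- by apply: Or33; split; lra.
- by exfalso; lra.
- by apply: Or31; split; lra.
Qed.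

(** a - soft_thr a is a subgradient of lam |.| at soft_thr a. *)
Lemma soft_thr_subgrad a : 0 <= lam ->
  `|a - soft_thr a| <= lam /\ (a - soft_thr a) * soft_thr a = lam * `|soft_thr a|.
Proof.
move=> lam0; have [[h ->]|[h ->]|[/andP[h1 h2] ->]] := soft_thrP a lam0.
- have -> : a - (a - lam) = lam by ring.
  by split; [rewrite ger0_norm | rewrite (ger0_norm (x := a - lam)) //; lra].
- have -> : a - (a + lam) = - lam by ring.
  rewrite normrN ger0_norm // ler0_norm; last lra.
  by split=> //; ring.
- by rewrite subr0 mulr0 normr0 mulr0 ler_norml; split=> //; lra.
Qed.

Lemma switch_norm a th : 0 <= lam -> switch lam `|a| th ->
  [\/ lam = 0 /\ th = 1, [/\ 0 < lam, th = 0 & - lam <= a <= lam],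
      [/\ 0 < lam, th = 1 & a <= - lam \/ lam <= a]
    | [/\ 0 < lam, a = lam \/ a = - lam & 0 <= th <= 1]].
Proof.
move=> lam0 sw; move: (lam0); rewrite le_eqVlt => /orP[/eqP l0|l0].
  by apply: Or41; split=> //; case/switchP: sw => [[_ [? _]]|[]|[? _ _]] //; lra.
case/switchP: sw => [[-> [_ h]]|[-> h]|[_ h t01]].
- by apply: Or42; split=> //; rewrite -ler_norml.
- by apply: Or43; split=> //; move: h; rewrite ler_normr => /orP[?|?];
    [right|left; lra].
- by apply: Or44; split=> //; move/eqP: h; rewrite eqr_norml => /andP[/orP[]/eqP];
    [left|right].
Qed.

(** A nonzero thresholded value occurs only strictly beyond the kink, where the
    slope is 1. *)
Lemma switch_mul_soft_thr a th : 0 <= lam -> switch lam `|a| th ->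
  th * soft_thr a = soft_thr a.
Proof.
move=> lam0 /(switch_norm lam0)[[_ ->]|[l0 _ ha]|[_ -> _]|[l0 ha _]];
  rewrite ?mul1r //; suff -> : soft_thr a = 0 by rewrite mulr0.
  by have [[? ->]|[? ->]|[/andP[? ?] ->]] := soft_thrP a lam0; lra.
by have [[? ->]|[? ->]|[/andP[? ?] ->]] := soft_thrP a lam0; case: ha => ?; lra.
Qed.

(** The threshold is piecewise affine: the segment from a to a nearby b stays
    in one closed piece, and if b is itself a kink then b = a. Hence the
    increment is exact for any slope admissible at b, not only at a. *)
Lemma soft_thr_switch_near a : 0 <= lam -> \forall b \near a, forall th,
  switch lam `|b| th -> soft_thr b - soft_thr a = th * (b - a).
Proof.
move=> lam0.
have nl c : \forall b \near a, a < c -> b < c.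
  have [ac|ca] := ltP a c; last by apply: (@nearW _ (nbhs a)).
  by apply: (@filterS _ (nbhs a)) (lt_nbhsl ac) => b ? _.
have nr c : \forall b \near a, c < a -> c < b.
  have [ac|ca] := ltP c a; last by apply: (@nearW _ (nbhs a)).
  by apply: (@filterS _ (nbhs a)) (lt_nbhsr ac) => b ? _.
near=> b => th sw.
have n1 : a < - lam -> b < - lam by near: b; exact: nl.
have n2 : a < lam -> b < lam by near: b; exact: nl.
have n3 : - lam < a -> - lam < b by near: b; exact: nr.
have n4 : lam < a -> lam < b by near: b; exact: nr.
case/(switch_norm lam0): sw => [[l0 ->]|[l0 -> /andP[? ?]]|[l0 -> hb]|[l0 hb t01]].
- by have [[? ->]|[? ->]|[/andP[? ?] ->]] := soft_thrP a lam0;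
    have [[? ->]|[? ->]|[/andP[? ?] ->]] := soft_thrP b lam0; lra.
- have sb : soft_thr b = 0.
    by have [[? ->]|[? ->]|[/andP[? ?] ->]] := soft_thrP b lam0; lra.
  rewrite sb mul0r.
  by have [[? ->]|[? ->]|[/andP[? ?] ->]] := soft_thrP a lam0; lra.
- rewrite mul1r.
  have [[? ->]|[? ->]|[/andP[? ?] ->]] := soft_thrP a lam0;
    have [[? ->]|[? ->]|[/andP[? ?] ->]] := soft_thrP b lam0; case: hb => hb; lra.
- suff -> : a = b by rewrite !subrr mulr0.
  by have [ab|ab|//] := ltgtP a b; case: hb => hb; lra.
Unshelve. all: by end_near. Qed.

Definition soft n (x : 'cV[R]_n) : 'cV[R]_n := \col_i soft_thr (x i 0).

Lemma Prox_varphi n (u : 'cV[R]_n) : 0 <= lam -> Prox (varphi lam) u = soft u.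
Proof.
move=> lam0; apply: Prox_subgradient => y.
rewrite /varphi /l1norm !mulr_sumr -big_split /=; apply: ler_sum => i _.
rewrite !mxE; have [sl ss] := soft_thr_subgrad (u i 0) lam0.
rewrite mulrBr ss addrC subrK.
apply: le_trans (ler_norm _) _; rewrite normrM; exact: ler_wpM2r.
Qed.

Lemma soft_near n (u : 'cV[R]_n) : 0 <= lam -> \forall x \near u,
  forall th : 'rV[R]_n, (forall i, switch lam `|(x : 'cV[R]_n) i 0| (th 0 i)) ->
  soft x - soft u = diag_mx th *m (x - u).
Proof.
move=> lam0.
have : \forall x \near u, forall i, forall th,
    switch lam `|(x : 'cV_n) i 0| th ->
    soft_thr (x i 0) - soft_thr (u i 0) = th * (x i 0 - u i 0).
  apply: (@filter_forall _ _ _ (nbhs u)) => i.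
  exact: (@coord_continuous R n 1 i 0 u) _ (soft_thr_switch_near (u i 0) lam0).
apply: filterS => x xu th sw; apply/colP => i.
by rewrite mul_diag_mx !mxE; apply: xu.
Qed.

(** The derivative of the threshold from the right. *)
Definition right_slope (a : R) : R := ((lam <= a) || (a < - lam))%:R.

Lemma right_slope_switch a : 0 <= lam -> switch lam `|a| (right_slope a).
Proof.
move=> lam0; rewrite /right_slope.
case: (boolP ((lam <= a) || (a < - lam))) => [/orP h|].
  by apply: switch1; rewrite ler_normr; apply/orP; case: h => h; [left|right; lra].
rewrite negb_or -ltNge -leNgt => /andP[? ?]; apply: switch0; first lra.
by rewrite ler_norml; apply/andP; split; lra.
Qed.

Lemma right_slope_near a : 0 <= lam ->
  \forall h \near 0^'+, soft_thr (a + h) - soft_thr a = h * right_slope a.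
Proof.
move=> lam0.
have bh : \forall h \near 0^'+, [/\ 0 < h, a < lam -> a + h <= lam
    & a < - lam -> a + h <= - lam].
  have nle c : \forall h \near 0^'+, a < c -> a + h <= c.
    have [ac|ca] := ltP a c; last exact: nearW.
    have /nbhs_right_le : 0 < c - a by rewrite subr_gt0.
    by apply: filterS => h hc _; rewrite -lerBrDl.
  by apply: filterS3 (nbhs_right_gt 0) (nle lam) (nle (- lam)).
apply: filterS bh => h [h0 h1 h2]; rewrite /right_slope.
have [la|al] := leP lam a; rewrite ?orTb ?orFb /= ?mulr1n.
  by have [[? ->]|[? ->]|[/andP[? ?] ->]] := soft_thrP (a + h) lam0;
    have [[? ->]|[? ->]|[/andP[? ?] ->]] := soft_thrP a lam0; lra.
have {}h1 := h1 al.
have [al'|al'] := ltP a (- lam); rewrite /= ?mulr1n ?mulr0n.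
  have {}h2 := h2 al'.
  by have [[? ->]|[? ->]|[/andP[? ?] ->]] := soft_thrP (a + h) lam0;
    have [[? ->]|[? ->]|[/andP[? ?] ->]] := soft_thrP a lam0; lra.
by have [[? ->]|[? ->]|[/andP[? ?] ->]] := soft_thrP (a + h) lam0;
    have [[? ->]|[? ->]|[/andP[? ?] ->]] := soft_thrP a lam0; lra.
Qed.

(** Diagonal matrices with admissible entries. Stating this entry by entry,
    rather than by the existence of a diagonal, makes closedness and convexity
    immediate. *)
Definition soft_slopes n (x : 'cV[R]_n) : set 'M[R]_n :=
  [set J | forall i j, if i == j then switch lam `|x i 0| (J i i)
    else J i j == 0].

Lemma soft_slopesP n (x : 'cV[R]_n) J : soft_slopes x J <->
  exists2 th : 'rV[R]_n, (forall i, switch lam `|x i 0| (th 0 i)) &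
    J = diag_mx th.
Proof.
split=> [xJ|[th sw ->] i j].
  exists (\row_i J i i) => [i|].
    by have := xJ i i; rewrite eqxx mxE.
  apply/matrixP => i j; rewrite !mxE; have := xJ i j.
  by case: eqVneq => [->|_ /eqP ->]; rewrite ?mulr1n ?mulr0n.
by case: eqVneq => [_|ij]; rewrite !mxE ?eqxx ?mulr1n // (negbTE ij) mulr0n.
Qed.

(** At a point of differentiability the Jacobian is given by the right
    derivatives; these are admissible whether or not the point is a kink. *)
Lemma jac_soft n (x : 'cV[R]_n) : 0 <= lam ->
  differentiable (@soft n) x -> soft_slopes x (jac (@soft n) x).
Proof.
move=> lam0 dx; apply/soft_slopesP.
exists (\row_i right_slope (x i 0)) => [i|].
  by rewrite mxE; exact: right_slope_switch.
apply: jac_eq => j; apply: (diff_direction (C := 0) dx).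
apply: filterS (right_slope_near (x j 0) lam0) => h hj.
rewrite mul0r (_ : _ - _ = 0) ?enorm0 //; apply/colP => i.
rewrite mul_diag_mx !mxE.
have [->|ij] := eqVneq i j.
  by rewrite !mulr1n !mulr1 hj subrr.
by rewrite !mulr0n !mulr0 addr0 !subrr.
Qed.

Lemma soft_slopes_convex n (x : 'cV[R]_n) J1 J2 t :
  soft_slopes x J1 -> soft_slopes x J2 -> 0 <= t <= 1 ->
  soft_slopes x (t *: J1 + (1 - t) *: J2).
Proof.
move=> h1 h2 t01 i j; have := h1 i j; have := h2 i j; rewrite !mxE.
case: eqVneq => [_ ? ?|_ /eqP -> /eqP ->]; first exact: switch_convex.
by rewrite !mulr0 addr0.
Qed.

Lemma closed_soft_slopes n :
  closed [set xJ : 'cV[R]_n * 'M[R]_n | soft_slopes xJ.1 xJ.2].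
Proof.
rewrite (_ : [set _ | _] = \bigcap_(ij in [set: 'I_n * 'I_n])
  [set xJ : 'cV[R]_n * 'M[R]_n | if ij.1 == ij.2
     then switch lam `|xJ.1 ij.1 0| (xJ.2 ij.1 ij.1)
     else xJ.2 ij.1 ij.2 == 0]); last first.
  apply/seteqP; split=> [xJ h [i j] _|xJ h i j]; first exact: (h i j).
  exact: (h (i, j)).
have J_cont (i j : 'I_n) :
    continuous (fun xJ : 'cV[R]_n * 'M[R]_n => xJ.2 i j).
  move=> xJ; apply: (@continuous_comp _ _ _ snd (fun M : 'M[R]_n => M i j)).
    exact: cvg_snd.
  exact: coord_continuous.
apply: closed_bigI => -[i j] _ /=; case: eqVneq => [_|_].
  apply: closed_switch => [xJ|]; last exact: J_cont.
  apply: (@continuous_comp _ _ _ (fun xJ : 'cV[R]_n * 'M[R]_n => xJ.1 i 0)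
    Num.norm); last exact: norm_continuous.
  apply: (@continuous_comp _ _ _ fst (fun M : 'cV[R]_n => M i 0)).
    exact: cvg_fst.
  exact: coord_continuous.
rewrite (_ : [set _ | _] = (fun xJ : 'cV[R]_n * 'M[R]_n => xJ.2 i j) @^-1`
   [set a | a = 0]); last by apply/seteqP; split=> xJ /= /eqP.
by apply: preimage_closed => [xJ _|]; [exact: J_cont | exact: closed_eq].
Qed.

(** A vertex of the box of admissible slopes is the Jacobian at points
    obtained by moving each kinked coordinate to the side that it selects. *)
Lemma Bsubdiff_soft n (u : 'cV[R]_n) (th : 'rV[R]_n) : 0 <= lam ->
  (forall i, switch lam `|u i 0| (th 0 i)) ->
  (forall i, th 0 i = 0 \/ th 0 i = 1) -> Bsubdiff (@soft n) u (diag_mx th).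
Proof.
move=> lam0 sw th01.
pose y_ k := \col_i (unkink lam `|u i 0| (th 0 i) k * u i 0) : 'cV[R]_n.
apply: (@Bsubdiff_limit _ _ _ _ _ _ y_ (fun=> diag_mx th) (fun=> 0)).
- move=> k.
  have st : \forall z \near y_ k, forall i,
      switch lam `|(z : 'cV[R]_n) i 0| (th 0 i).
    apply: (@filter_forall _ _ _ (nbhs (y_ k))) => i.
    have nc : {for y_ k, continuous (fun z : 'cV[R]_n => `|z i 0|)}.
      apply: (@continuous_comp _ _ _ (fun z : 'cV[R]_n => z i 0) Num.norm).
        exact: coord_continuous.
      exact: norm_continuous.
    have yE : `|y_ k i 0| = unkink lam `|u i 0| (th 0 i) k * `|u i 0|.
      by rewrite mxE normrM ger0_norm // unkink_ge0.
    have := unkink_switch k (normr_ge0 (u i 0)) lam0 (th01 i) (sw i).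
    rewrite -yE.
    move=> /nc; apply: (@filterS _ (nbhs (y_ k))) => z /= h; exact: h.
  apply: filterS2 st (soft_near (y_ k) lam0) => z zs /(_ th zs) ->.
  by rewrite subrr enorm0 mul0r.
- apply: cvg_mx => i j; rewrite (ord1 j).
  rewrite (_ : (fun k => y_ k i 0) =
    fun k => unkink lam `|u i 0| (th 0 i) k * u i 0); last first.
    by apply/funext => k; rewrite mxE.
  have : unkink lam `|u i 0| (th 0 i) k * u i 0 @[k --> \oo] --> 1 * u i 0.
    by apply: cvgM; [exact: unkink_cvg | exact: cvg_cst].
  by rewrite mul1r.
- exact: cvg_cst.
Qed.

(** The admissible slopes form a box with vertices in the B-subdifferential. A
    box is the convex hull of its vertices, by interpolating one coordinate
    at a time. *)
Theorem clarke_soft n (u : 'cV[R]_n) : 0 <= lam ->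
  clarke (@soft n) u = soft_slopes u.
Proof.
move=> lam0; apply/seteqP; split.
  apply: clarke_sub; last exact: soft_slopes_convex.
  by apply: Bsubdiff_sub; [move=> y; exact: jac_soft | exact: closed_soft_slopes].
move=> J /soft_slopesP[th sw ->{J}].
(* Only the first k slopes may lie strictly between 0 and 1. *)
have : forall k, forall th : 'rV[R]_n, (forall i, switch lam `|u i 0| (th 0 i)) ->
    (forall i : 'I_n, (k <= i)%N -> th 0 i = 0 \/ th 0 i = 1) ->
    clarke (@soft n) u (diag_mx th).
  elim=> [|k IHk] {sw}th sw th01.
    by apply: Bsubdiff_clarke; apply: Bsubdiff_soft => // i; exact: th01.
  have [nk|kn] := leqP n k.
    apply: IHk => // i ki; have := ltn_ord i.
    by rewrite ltnNge (leq_trans nk ki).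
  pose k' := Ordinal kn.
  pose th' c := \row_i (if i == k' then c else th 0 i).
  have th'P c : (c = 0 \/ c = 1) -> switch lam `|u k' 0| c ->
      clarke (@soft n) u (diag_mx (th' c)).
    move=> c01 swc; apply: IHk => i; rewrite mxE.
      by case: eqVneq => [->|].
    case: eqVneq => // ik ki; apply: th01.
    by rewrite ltn_neqAle ki andbT eq_sym.
  have th'E c : th 0 k' = c -> th' c = th.
    move=> thc; apply/rowP => i; rewrite mxE; case: eqVneq => // ->.
    by rewrite thc.
  case/switchP: (sw k') => [[t0 _]|[t1 _]|[l0 ul t01]].
  - rewrite -(th'E _ t0); apply: th'P; first by left.
    by move: (sw k'); rewrite t0.
  - rewrite -(th'E _ t1); apply: th'P; first by right.
    by move: (sw k'); rewrite t1.
  - rewrite (_ : diag_mx th = th 0 k' *: diag_mx (th' 1) +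
      (1 - th 0 k') *: diag_mx (th' 0)).
      apply: clarke_segment => //; apply: th'P; [by right| | by left|].
        by rewrite ul; exact: switch1.
      by rewrite ul; exact: switch0.
    apply/matrixP => i j; rewrite !mxE; case: (eqVneq i j) => _.
      by case: (eqVneq i k') => [->|_]; rewrite !mulr1n; ring.
    by rewrite !mulr0n !mulr0 addr0.
move=> /(_ n th sw); apply=> i ni; have := ltn_ord i; by rewrite ltnNge ni.
Qed.

End Soft.

(** * The projection onto a ball *)

Section Ball.
Context {R : realType} (r : R).

(** The scalar core of bproj_err, with a = |x|, b = |y|, H = |y - x| and
    e = y . (y - x). Once e is eliminated by the cosine rule, the terms of first
    order in b - a cancel in the first summand; the second summand is a product
    of two factors of first order. *)
Lemma proj_scalar_bound (a b H e : R) : 0 < r -> r <= a -> r <= b ->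
  `|b - a| <= H -> e = (b ^+ 2 - a ^+ 2 + H ^+ 2) / 2 ->
  `|r / b - r / a + r * e / b ^+ 3| * b + `|r / a - r / b| * H
    <= 4 / r * H ^+ 2.
Proof.
move=> r0 ra rb dH eE.
have a0 : 0 < a by exact: lt_le_trans ra.
have b0 : 0 < b by exact: lt_le_trans rb.
have H0 : 0 <= H by exact: le_trans dH.
have p0 : 0 < a^-1 by rewrite invr_gt0.
have q0 : 0 < b^-1 by rewrite invr_gt0.
have ps : a^-1 <= r^-1 by rewrite lef_pV2.
have qs : b^-1 <= r^-1 by rewrite lef_pV2.
have s0 : 0 < r^-1 by rewrite invr_gt0.
have pq : a^-1 * b^-1 <= r^-1 ^+ 2 by rewrite expr2 ler_pM // ltW.
have qq : b^-1 ^+ 2 <= r^-1 ^+ 2 by rewrite !expr2 ler_pM // ltW.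
have dd : (b - a) ^+ 2 <= H ^+ 2.
  by rewrite -(real_normK (num_real (b - a))) ler_pXn2r // nnegrE.
have rs2 : r * r^-1 ^+ 2 = r^-1 by rewrite expr2 mulrA divff ?mul1r // gt_eqF.
have first : `|r / b - r / a + r * e / b ^+ 3| * b <= 2 / r * H ^+ 2.
  rewrite (_ : _ * b = `|(r / b - r / a + r * e / b ^+ 3) * b|); last first.
    by rewrite normrM (gtr0_norm b0).
  have -> : (r / b - r / a + r * e / b ^+ 3) * b = r *
    (H ^+ 2 * b^-1 ^+ 2 / 2 - (b - a) ^+ 2 * (b^-1 ^+ 2 / 2 + a^-1 * b^-1)).
    by rewrite eE; field; rewrite !gt_eqF.
  rewrite normrM gtr0_norm // (_ : 2 / r * _ = r * (2 * r^-1 ^+ 2 * H ^+ 2));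
    last by rewrite -{1}rs2; ring.
  rewrite ler_pM2l //.
  set D := (b - a) ^+ 2 in dd *; set u := b^-1 ^+ 2 in qq *.
  set v := a^-1 * b^-1 in pq *; set s2 := r^-1 ^+ 2 in qq pq *.
  have D0 : 0 <= D by rewrite sqr_ge0.
  have u0 : 0 <= u by rewrite sqr_ge0.
  have v0 : 0 <= v by rewrite mulr_ge0 // ltW.
  have H2 : 0 <= H ^+ 2 by rewrite sqr_ge0.
  have h1 : 0 <= H ^+ 2 * u <= H ^+ 2 * s2 by rewrite mulr_ge0 // ler_wpM2l.
  have h2 : 0 <= D * (u / 2 + v) by apply: mulr_ge0 => //; lra.
  have h3 : D * (u / 2 + v) <= H ^+ 2 * (s2 / 2 + s2).
    by apply: ler_pM => //; lra.
  by rewrite ler_norml; lra.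
have second : `|r / a - r / b| * H <= r^-1 * H ^+ 2.
  rewrite expr2 mulrA ler_wpM2r //.
  have -> : r / a - r / b = r * (a^-1 * b^-1 * (b - a)).
    by field; rewrite !gt_eqF.
  rewrite !normrM (gtr0_norm r0) (gtr0_norm p0) (gtr0_norm q0).
  rewrite -[X in _ <= X * _]rs2 -(mulrA r).
  by rewrite ler_pM2l //; apply: ler_pM => //; rewrite mulr_ge0 // ltW.
by apply: le_trans (lerD first second) _; have := sqr_ge0 H; nra.
Qed.

(** One formula for both sides of the sphere. For r = 0 it is the constant 0,
    including at the origin, where 0 / 0 = 0. *)
Definition bproj n (x : 'cV[R]_n) : 'cV[R]_n :=
  (r / Num.max r (enorm x)) *: x.

(** The derivative of bproj at x, inside the ball for t = 0 and outside for
    t = 1. The maximum makes it jointly continuous in (t, x). *)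
Definition bproj_slope n (t : R) (x : 'cV[R]_n) : 'M[R]_n :=
  let m := Num.max r (enorm x) in
  (r / m) *: (1%:M - (t / m ^+ 2) *: (x *m x^T)).

Lemma bproj_slopeE n t (x h : 'cV[R]_n) : bproj_slope t x *m h =
  (r / Num.max r (enorm x)) *:
    (h - (t / Num.max r (enorm x) ^+ 2 * dotp x h) *: x).
Proof.
rewrite /bproj_slope -scalemxAl mulmxBl mul1mx -scalemxAl -mulmxA.
congr (_ *: (_ - _)); rewrite -scalerA; congr (_ *: _).
by apply/colP => i; rewrite !mxE big_ord1 -dotpE mulrC.
Qed.

Definition bproj_ratio n (x : 'cV[R]_n) := r / Num.max r (enorm x).

(** The last clause is complementarity: the point is shrunk only if its
    image lies on the sphere. *)
Lemma bproj_ratioP n (x : 'cV[R]_n) : 0 <= r ->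
  [/\ 0 <= bproj_ratio x, bproj_ratio x <= 1, bproj_ratio x * enorm x <= r
    & bproj_ratio x = 1 \/ bproj_ratio x * enorm x = r].
Proof.
move=> r0; have x0 := enorm_ge0 x; rewrite /bproj_ratio.
case: (ltP r (enorm x)) => rx.
  have x1 : 0 < enorm x by exact: le_lt_trans rx.
  rewrite divfK ?gt_eqF //; split=> //; last by right.
    by rewrite divr_ge0.
  by rewrite ler_pdivrMr // mul1r ltW.
move: r0; rewrite le_eqVlt => /orP[/eqP r0|r0].
  by rewrite -r0 mul0r mul0r; split=> //; right.
by rewrite divff ?gt_eqF // mul1r; split=> //; left.
Qed.

Lemma bproj_in n (x : 'cV[R]_n) : 0 <= r -> enorm x <= r -> bproj x = x.
Proof.
move=> r0 xr; rewrite /bproj max_l //.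
move: r0; rewrite le_eqVlt => /orP[/eqP r0|r0]; last first.
  by rewrite divff ?gt_eqF // scale1r.
rewrite (_ : x = 0) ?scaler0 //; apply: enorm_eq0; apply/le_anti.
by rewrite {1}r0 xr enorm_ge0.
Qed.

(** x - bproj x makes a non-acute angle with y - bproj x for every y in the
    ball, by Cauchy-Schwarz and complementarity. *)
Lemma proj_ball2 n (x : 'cV[R]_n) : 0 <= r -> Defs.proj (ball2 r) x = bproj x.
Proof.
move=> r0; have [c0 c1 cr cd] := bproj_ratioP x r0; have xx := enorm_ge0 x.
have pE : bproj x = bproj_ratio x *: x by [].
apply: argmin_eq.
  by rewrite /ball2 /= pE enormZ ger0_norm.
move=> y yr yx; apply/subr0_eq/enorm_eq0.
apply/eqP; rewrite -sqrf_eq0; apply/eqP/le_anti; rewrite sqr_ge0 andbT.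
have : 0 <= dotp (y - bproj x) (bproj x - x).
  rewrite pE (_ : _ *: x - x = (bproj_ratio x - 1) *: x); last first.
    by rewrite scalerBl scale1r.
  rewrite dotpZr dotpDl dotpNl dotpZl -sqr_enorm.
  case: cd => [->|cr']; first by rewrite subrr mul0r.
  have := dotp_le y x; have : enorm y * enorm x <= r * enorm x.
    by rewrite ler_wpM2r.
  by move: yr; rewrite /ball2 /= expr2 mulrA cr'; nra.
have : enorm (y - x) ^+ 2 <= enorm (bproj x - x) ^+ 2.
  by rewrite ler_pXn2r // nnegrE enorm_ge0.
have := sqr_enormD (y - bproj x) (bproj x - x).
rewrite addrA subrK; lra.
Qed.

(** Inside the ball the projection is the identity and the error vanishes.
    Outside, y - x is decomposed along y and h = y - x, and
    proj_scalar_bound bounds the two coefficients. *)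
Lemma bproj_err n (x y : 'cV[R]_n) t : 0 <= r ->
  [/\ t = 0, enorm x <= r & enorm y <= r] \/
  [/\ t = 1, r <= enorm x & r <= enorm y] ->
  enorm (bproj y - bproj x - bproj_slope t y *m (y - x)) <=
    4 / r * enorm (y - x) ^+ 2.
Proof.
rewrite le_eqVlt => /orP[/eqP r0|r0].
  move=> _; rewrite bproj_slopeE /bproj -r0 !mul0r !scale0r !subr0 enorm0.
  by rewrite invr0 mulr0 mul0r.
case=> [[-> xr yr]|[-> rx ry]].
  rewrite !bproj_in ?(ltW r0) // bproj_slopeE max_l // divff ?gt_eqF //.
  rewrite !mul0r scale0r subr0 scale1r subrr enorm0.
  by rewrite mulr_ge0 ?sqr_ge0 // divr_ge0 // ltW.
rewrite bproj_slopeE /bproj !max_r //.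
set b := enorm y; set a := enorm x; set h := y - x.
have xE : x = y - h by rewrite opprB addrC subrK.
have dH : `|b - a| <= enorm h by exact: ler_dist_enorm.
have eE : dotp y h = (b ^+ 2 - a ^+ 2 + enorm h ^+ 2) / 2.
  by rewrite /a xE sqr_enormD enormN dotpNr -/b; field.
apply: le_trans (proj_scalar_bound r0 rx ry dH eE).
have -> : (r / b) *: y - (r / a) *: x - (r / b) *: (h - (1 / b ^+ 2 * dotp y h) *: y)
   = (r / b - r / a + r * dotp y h / b ^+ 3) *: y + (r / a - r / b) *: h.
  rewrite {1}xE; apply/colP => i; rewrite !mxE; field.
  by rewrite !gt_eqF // (lt_le_trans r0).
apply: le_trans (enormD _ _) _; rewrite !enormZ; exact: lexx.
Qed.

(** bproj_err with the derivative taken at the other endpoint; the hypothesis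
    is symmetric in x and y. *)
Lemma bproj_err_base n (x y : 'cV[R]_n) t : 0 <= r ->
  [/\ t = 0, enorm x <= r & enorm y <= r] \/
  [/\ t = 1, r <= enorm x & r <= enorm y] ->
  enorm (bproj y - bproj x - bproj_slope t x *m (y - x)) <=
    4 / r * enorm (y - x) ^+ 2.
Proof.
move=> r0 side; have {}side : [/\ t = 0, enorm y <= r & enorm x <= r] \/
    [/\ t = 1, r <= enorm y & r <= enorm x].
  by case: side => [[? ? ?]|[? ? ?]]; [left|right].
have := bproj_err r0 side; rewrite -(opprB y x) mulmxN (enormN (y - x)).
by rewrite -enormN opprD opprB !opprK.
Qed.

(** On the sphere both points are fixed, so the error is proportional to t and
    the case t = 1 of bproj_err suffices. *)
Lemma bproj_err_mix n (x y : 'cV[R]_n) t : 0 <= r -> 0 <= t <= 1 ->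
  enorm x = r -> enorm y = r ->
  enorm (bproj y - bproj x - bproj_slope t y *m (y - x)) <=
    4 / r * enorm (y - x) ^+ 2.
Proof.
move=> r0 /andP[t0 t1] xr yr.
have h1 : [/\ 1 = 1 :> R, r <= enorm x & r <= enorm y] by rewrite xr yr.
have E1 := bproj_err r0 (or_intror h1).
apply: le_trans E1.
rewrite !bproj_slopeE !bproj_in ?xr ?yr // maxxx.
move: r0; rewrite le_eqVlt => /orP[/eqP r0|r0].
  by rewrite -r0 !mul0r !scale0r lexx.
rewrite divff ?gt_eqF // !scale1r.
have E c : y - x - (y - x - c *: y) = c *: y by rewrite opprB addrC subrK.
rewrite !E !enormZ ler_wpM2r ?enorm_ge0 // -!mulrA !normrM ler_wpM2r //.
by rewrite normr1 ger0_norm.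
Qed.


(** If x is off the sphere, then so is y, on the same side. If x is on the
    sphere, then x lies on the closed side of y, whichever it is; only when y
    is on the sphere too can the slope be intermediate. *)
Lemma bproj_near n (x : 'cV[R]_n) : 0 <= r ->
  \forall y \near x, forall t, switch r (enorm y) t ->
  enorm (bproj y - bproj x - bproj_slope t y *m (y - x)) <=
    4 / r * enorm (y - x) ^+ 2.
Proof.
move=> r0; have ec := @enorm_continuous R n x.
have near_lt : \forall y \near x, enorm x < r -> enorm (y : 'cV[R]_n) < r.
  have [xr|rx] := ltP (enorm x) r; last by apply: (@nearW _ (nbhs x)).
  by apply: (@filterS _ (nbhs x)) (ec _ (lt_nbhsl xr)) => y /= yr _.
have near_gt : \forall y \near x, r < enorm x -> r < enorm (y : 'cV[R]_n).
  have [xr|rx] := ltP r (enorm x); last by apply: (@nearW _ (nbhs x)).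
  by apply: (@filterS _ (nbhs x)) (ec _ (lt_nbhsr xr)) => y /= yr _.
apply: filterS2 near_lt near_gt => y yl yg t.
case/switchP => [[-> [rp yr]]|[-> yr]|[rp yr t01]].
- apply: bproj_err => //; left; split=> //.
  by rewrite leNgt; apply/negP => /yg; rewrite ltNge yr.
- apply: bproj_err => //; right; split=> //.
  by rewrite leNgt; apply/negP => /yl; rewrite ltNge yr.
- apply: bproj_err_mix => //; apply/le_anti/andP; split.
    by rewrite leNgt; apply/negP => /yg; rewrite yr ltxx.
  by rewrite leNgt; apply/negP => /yl; rewrite yr ltxx.
Qed.

Lemma bproj_slope_continuous (T : topologicalType) n (t : T -> R)
    (x : T -> 'cV[R]_n) :
  0 <= r -> continuous t -> continuous x ->
  continuous (fun p => bproj_slope (t p) (x p)).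
Proof.
move=> r0 tc xc; move: r0; rewrite le_eqVlt => /orP[/eqP rE|r0].
  rewrite (_ : (fun _ => _) = cst 0); first exact: cst_continuous.
  by apply/funext => p; rewrite /bproj_slope -rE mul0r scale0r.
have mc : continuous (fun p => Num.max r (enorm (x p))).
  move=> p; apply: (@continuous_max _ _ (cst r) (fun p => enorm (x p))).
    exact: cst_continuous.
  by apply: (@continuous_comp _ _ _ x (@enorm R n)); [exact: xc|
     exact: enorm_continuous].
have m0 p : Num.max r (enorm (x p)) != 0 by rewrite gt_eqF // lt_max r0.
have ic : continuous (fun p => (Num.max r (enorm (x p)))^-1).
  by move=> p; apply: cvgV => //; exact: mc.
have xic i : continuous (fun p => x p i 0) by exact: continuous_coord.
apply: mx_continuous => i j.
rewrite (_ : (fun _ => _) = fun p => r * (Num.max r (enorm (x p)))^-1 *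
  ((i == j)%:R - t p * (Num.max r (enorm (x p)))^-1 *
    (Num.max r (enorm (x p)))^-1 * (x p i 0 * x p j 0))); last first.
  apply/funext => p; rewrite /bproj_slope !mxE big_ord1 !mxE.
  by rewrite expr2 invfM !mulrA.
have cB (f g : T -> R) : continuous f -> continuous g ->
    continuous (fun p => f p - g p).
  by move=> fc gc p; apply: continuousB; [exact: fc | exact: gc].
have cC (c : R) : continuous (fun _ : T => c) by exact: cst_continuous.
apply: continuous_mulr; first exact: continuous_mulr.
apply: (cB _ _ (cC _)); apply: continuous_mulr; last exact: continuous_mulr.
by apply: continuous_mulr => //; exact: continuous_mulr.
Qed.

(** On the sphere, one of the directions e_j and - e_j does not point inwards,
    so that a half-line stays outside the ball: a differential can only be
    the outer derivative. *)
Lemma jac_bproj n (x : 'cV[R]_n) : 0 <= r -> differentiable (@bproj n) x ->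
  jac (@bproj n) x = if enorm x < r then bproj_slope 0 x else bproj_slope 1 x.
Proof.
move=> r0 dx; have err t v : 
    (\forall h \near 0^'+, [/\ t = 0, enorm x <= r & enorm (x + h *: v) <= r] \/
      [/\ t = 1, r <= enorm x & r <= enorm (x + h *: v)]) ->
    'd (@bproj n) x v = bproj_slope t x *m v.
  move=> hv; apply: (diff_direction (C := 4 / r * enorm v ^+ 2) dx).
  apply: filterS2 (nbhs_right_gt 0) hv => h h0 hv.
  have := bproj_err_base r0 hv.
  rewrite (addrC x) addrK enormZ gtr0_norm // -scalemxAr.
  by rewrite exprMn mulrCA mulrC -mulrA mulrCA.
case: ltP => rx; apply: jac_eq => j.
  apply: err; set e := enorm (delta_mx j 0 : 'cV[R]_n).
  have e1 : 0 < e + 1 by rewrite ltr_wpDl // enorm_ge0.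
  have /nbhs_right_le : 0 < (r - enorm x) / (e + 1).
    by rewrite divr_gt0 // subr_gt0.
  apply: filterS2 (nbhs_right_gt 0) => h h0; rewrite ler_pdivlMr // => hr.
  left; split=> //; first exact: ltW.
  apply: le_trans (enormD _ _) _; rewrite enormZ gtr0_norm // -/e.
  have := enorm_ge0 (delta_mx j 0 : 'cV[R]_n); rewrite -/e; nra.
have dir s : 0 <= s * x j 0 -> 
  'd (@bproj n) x (s *: delta_mx j 0) = bproj_slope 1 x *m (s *: delta_mx j 0).
  move=> sx; apply: err; apply: filterS (nbhs_right_gt 0) => h h0.
  right; split=> //; apply: le_trans rx _.
  rewrite -(@ler_pXn2r _ 2) ?nnegrE ?enorm_ge0 // sqr_enormD -addrA lerDl.
  rewrite addr_ge0 ?sqr_ge0 // mulr_ge0 // !dotpZr mulr_ge0 ?(ltW h0) //.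
  by rewrite dotpE -colE !mxE.
have [xj|xj] := leP 0 (x j 0).
  by have := dir 1; rewrite mul1r !scale1r; apply.
have := dir (- 1); rewrite mulN1r oppr_ge0 !scaleN1r => /(_ (ltW xj)).
by rewrite linearN mulmxN => /oppr_inj.
Qed.

Definition bproj_slopes n (x : 'cV[R]_n) : set 'M[R]_n :=
  [set J | exists2 t, switch r (enorm x) t & J = bproj_slope t x].

Lemma bproj_slope_affine n (x : 'cV[R]_n) s t1 t2 :
  bproj_slope (s * t1 + (1 - s) * t2) x =
  s *: bproj_slope t1 x + (1 - s) *: bproj_slope t2 x.
Proof.
by rewrite /bproj_slope; apply/matrixP => i j; rewrite !mxE; ring.
Qed.

Lemma Bsubdiff_bproj n (x : 'cV[R]_n) t : 0 <= r -> switch r (enorm x) t ->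
  (t = 0 \/ t = 1) -> Bsubdiff (@bproj n) x (bproj_slope t x).
Proof.
move=> r0 sw t01.
pose y_ k := unkink r (enorm x) t k *: x.
have yx : y_ @ \oo --> x.
  rewrite -[X in _ --> X]scale1r; apply: cvgZ; last exact: cvg_cst.
  exact: unkink_cvg.
apply: (@Bsubdiff_limit _ _ _ _ _ _ y_ (fun k => bproj_slope t (y_ k))
  (fun=> 4 / r)) => //.
- move=> k.
  have yE : enorm (y_ k) = unkink r (enorm x) t k * enorm x.
    by rewrite enormZ ger0_norm // unkink_ge0.
  have := unkink_switch k (enorm_ge0 x) r0 t01 sw; rewrite -yE => st.
  have swy := nbhs_singleton st (enorm_ge0 _).
  have {}st := @enorm_continuous R n (y_ k) _ st.
  apply: (@filterS _ (nbhs (y_ k))) st => z /= /(_ (enorm_ge0 _)) swz.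
  exact: bproj_err_base (switch_side swy swz t01).
- have Pc : continuous (fun y : 'cV[R]_n => bproj_slope t y).
    apply: (@bproj_slope_continuous _ _ (fun=> t) id) => //; first exact: cst_continuous.
    by move=> ?; exact: cvg_id.
  exact: (cvg_comp _ _ yx (Pc x)).
Qed.

Lemma bproj_slopes_convex n (x : 'cV[R]_n) J1 J2 s :
  bproj_slopes x J1 -> bproj_slopes x J2 -> 0 <= s <= 1 ->
  bproj_slopes x (s *: J1 + (1 - s) *: J2).
Proof.
move=> [t1 sw1 ->] [t2 sw2 ->] s01; exists (s * t1 + (1 - s) * t2).
  exact: switch_convex.
by rewrite bproj_slope_affine.
Qed.

(** The Jacobians use the slopes 0 and 1 only, and the corresponding relation
    is the union of two closed ones. *)
Lemma Bsubdiff_bproj_sub n (x : 'cV[R]_n) : 0 <= r ->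
  Bsubdiff (@bproj n) x `<=` bproj_slopes x.
Proof.
move=> r0.
pose V (y : 'cV[R]_n) : set 'M[R]_n := [set J |
  (enorm y <= r /\ J = bproj_slope 0 y) \/ (r <= enorm y /\ J = bproj_slope 1 y)].
have VT : V x `<=` bproj_slopes x.
  move=> J [[xr ->]|[rx ->]]; last by exists 1 => //; exact: switch1.
  move: r0; rewrite le_eqVlt => /orP[/eqP rE|rp]; last first.
    by exists 0 => //; exact: switch0.
  exists 1; first by apply: switch1; rewrite -rE enorm_ge0.
  by rewrite /bproj_slope -rE !mul0r !scale0r.
apply: subset_trans VT; apply: Bsubdiff_sub => [y dy|].
  rewrite jac_bproj // /V /=; case: ltP => [/ltW|] ?; [left|right]; split=> //.
have cl1 (D : set R) : closed D ->
    closed [set yJ : 'cV[R]_n * 'M[R]_n | D (enorm yJ.1)].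
  move=> cD; apply: (@preimage_closed _ _ (fun yJ => enorm yJ.1) D _ cD) => yJ _.
  apply: (@continuous_comp _ _ _ fst (@enorm R n)); first exact: cvg_fst.
  exact: enorm_continuous.
have cl2 t : closed [set yJ : 'cV[R]_n * 'M[R]_n | yJ.2 = bproj_slope t yJ.1].
  rewrite (_ : [set _ | _] =
    (fun yJ : 'cV[R]_n * 'M[R]_n => yJ.2 - bproj_slope t yJ.1) @^-1` [set 0]);
    last first.
    by apply/seteqP; split=> yJ /= [/eqP]; rewrite ?subr_eq0 => /eqP //;
       move=> ->; rewrite subrr.
  apply: preimage_closed => [yJ _|].
    apply: continuousB; first exact: cvg_snd.
    apply: (@bproj_slope_continuous _ _ (fun=> t) fst) => //; first exact: cst_continuous.
    by move=> ?; exact: cvg_fst.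
  exact: (accessible_closed_set1 (hausdorff_accessible (@norm_hausdorff _ _))).
rewrite (_ : [set _ | _] =
  ([set yJ : 'cV[R]_n * 'M[R]_n | enorm yJ.1 <= r] `&`
   [set yJ | yJ.2 = bproj_slope 0 yJ.1]) `|`
  ([set yJ : 'cV[R]_n * 'M[R]_n | r <= enorm yJ.1] `&`
   [set yJ | yJ.2 = bproj_slope 1 yJ.1])) //.
apply: closedU; apply: closedI => //.
  exact: (cl1 _ (@closed_le _ r)).
exact: (cl1 _ (@closed_ge _ r)).
Qed.

Theorem clarke_bproj n (x : 'cV[R]_n) : 0 <= r ->
  clarke (@bproj n) x = bproj_slopes x.
Proof.
move=> r0; apply/seteqP; split.
  apply: clarke_sub; last exact: bproj_slopes_convex.
  exact: Bsubdiff_bproj_sub.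
move=> _ [t sw ->].
have B t' : t' = 0 \/ t' = 1 -> switch r (enorm x) t' ->
    clarke (@bproj n) x (bproj_slope t' x).
  by move=> ? ?; apply: Bsubdiff_clarke; exact: Bsubdiff_bproj.
case/switchP: (sw) => [[t0 _]|[t1 _]|[rp xr t01]].
- by apply: B => //; left.
- by apply: B => //; right.
- rewrite (_ : t = t * 1 + (1 - t) * 0); last by ring.
  rewrite bproj_slope_affine; apply: clarke_segment => //; apply: B; rewrite ?xr.
  + by right.
  + exact: switch1.
  + by left.
  + exact: switch0.
Qed.

End Ball.

(** * Groups of coordinates and the prox of the regularizer *)

Section Blocks.
Context {R : realType}.

(** A partition is encoded from here on by the map from an index to the label
    of its block. *)
Lemma partition_label n g (G : 'I_g -> {set 'I_n}) : is_partition G ->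
  exists b : 'I_n -> 'I_g, forall i l, (i \in G l) = (l == b i).
Proof.
move=> [injG /and3P[/eqP covG /finset.trivIsetP trivG _]].
have ex i : exists l, i \in G l.
  have : i \in [set: 'I_n]%SET by rewrite finset.in_setT.
  rewrite -covG => /finset.bigcupP[B /imsetP[l _ ->] iB]; by exists l.
exists (fun i => xchoose (ex i)) => i l.
apply/idP/eqP => [il|->]; last exact: (xchooseP (ex i)).
apply: injG; apply/eqP; apply: contraT => neq.
have /finset.disjoint_setI0/finset.setP/(_ i) :=
  trivG _ _ (imset_f G (finset.in_setT l))
  (imset_f G (finset.in_setT (xchoose (ex i)))) neq.
rewrite finset.in_setI finset.in_set0 il /= => /negP; case; exact: (xchooseP (ex i)).
Qed.

Lemma restrE n (A : {set 'I_n}) (x : 'cV[R]_n) : restr A x = Pblock A *m x.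
Proof. by rewrite /restr rowsubE. Qed.

Lemma Pblock_coord n (A : {set 'I_n}) (x : 'cV[R]_n) k :
  (Pblock A *m x) k 0 = x (enum_val k) 0.
Proof. by rewrite -restrE mxE. Qed.

Lemma Pblock_mul_tr n (A : {set 'I_n}) :
  Pblock A *m (Pblock A)^T = 1%:M :> 'M[R]_#|A|.
Proof.
apply/matrixP => i j; rewrite /Pblock mul_rowsub_mx mul1mx !mxE.
by rewrite (inj_eq enum_val_inj) eq_sym.
Qed.

Lemma tr_mul_Pblock n (A : {set 'I_n}) :
  (Pblock A)^T *m Pblock A = diag_mx (\row_i (i \in A)%:R) :> 'M[R]_n.
Proof.
apply/matrixP => i j; rewrite !mxE.
transitivity (\sum_(k < #|A|) ((enum_val k == i) && (enum_val k == j))%:R : R).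
  by apply: eq_bigr => k _; rewrite !mxE -natrM mulnb.
transitivity (\sum_(k in A) ((k == i) && (k == j))%:R : R).
  by rewrite [RHS]big_enum_val.
have [<-|ij] := eqVneq i j; rewrite ?mulr1n ?mulr0n.
  under eq_bigr do rewrite andbb.
  have [iA|iA] := boolP (i \in A).
    rewrite (bigD1 i) //= eqxx big1 ?addr0 // => k /andP[_ /negbTE ->].
    by [].
  by rewrite big1 // => k kA; case: eqVneq => // ki; rewrite -ki kA in iA.
rewrite big1 // => k _; case: eqVneq => //= ->.
by rewrite (negbTE ij).
Qed.

Lemma enorm_trPblock n (A : {set 'I_n}) (e : 'cV[R]_#|A|) :
  enorm ((Pblock A)^T *m e) = enorm e.
Proof.
apply/eqP; rewrite -(@eqrXn2 _ 2) ?enorm_ge0 // !sqr_enorm.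
by rewrite dotp_trmx mulmxA Pblock_mul_tr mul1mx.
Qed.

Lemma enorm_Pblock n (A : {set 'I_n}) (h : 'cV[R]_n) :
  enorm (Pblock A *m h) <= enorm h.
Proof.
rewrite -(@ler_pXn2r _ 2) ?nnegrE ?enorm_ge0 // !sqr_enorm.
rewrite -dotp_trmx mulmxA tr_mul_Pblock; apply: ler_sum => i _.
rewrite mul_diag_mx !mxE -mulrA; case: (i \in A); rewrite ?mul1r // mul0r.
by rewrite -expr2 sqr_ge0.
Qed.

End Blocks.

Section Regularizer.
Context {R : realType} {n g : nat} (lam : R) (r : 'I_g -> R)
  (G : 'I_g -> {set 'I_n}) (b : 'I_n -> 'I_g).

Local Notation P l := (@Pblock R n (G l)).

Lemma block_scale (c : 'I_g -> R) (v : 'cV[R]_n) i :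
  (forall i l, (i \in G l) = (l == b i)) ->
  (\sum_l (P l)^T *m (c l *: (P l *m v))) i 0 = c (b i) * v i 0.
Proof.
move=> Gb; rewrite summxE (bigD1 (b i)) //= big1 ?addr0 => [|l lb];
  rewrite -scalemxAr mulmxA tr_mul_Pblock mul_diag_mx !mxE Gb.
  by rewrite eqxx mul1r.
by rewrite (negbTE lb) mul0r mulr0.
Qed.

Definition sgl_prox (u : 'cV[R]_n) : 'cV[R]_n :=
  soft lam u - \sum_l (P l)^T *m bproj (r l) (P l *m soft lam u).

(** The residual u - X splits as (u - v) + sum_l P_l^T Pi_l(v). The first part
    is a subgradient of the l1 term at v, hence at X, whose coordinates are
    nonnegative multiples of those of v. Each Pi_l(v) has norm at most r_l;
    if P_l X <> 0, it is a nonnegative multiple of P_l X of norm exactly r_l, by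
    complementarity. So r_l |P_l X| = Pi_l(v) . P_l X, which makes it a
    subgradient of r_l |.| at P_l X. *)
Lemma Prox_sgl (q : 'cV[R]_n -> R) u : 0 <= lam -> (forall l, 0 <= r l) ->
  (forall i l, (i \in G l) = (l == b i)) ->
  (forall x, q x = varphi lam x + \sum_l r l * enorm (restr (G l) x)) ->
  Prox q u = sgl_prox u.
Proof.
move=> lam0 r0 Gb qE; set v := soft lam u; set X := sgl_prox u.
pose c l := bproj_ratio (r l) (P l *m v).
have XE i : X i 0 = (1 - c (b i)) * v i 0.
  rewrite /X /sgl_prox -/v mxE [X in _ + X]mxE (block_scale c) //.
  by rewrite mulrBl mul1r.
have PX l : P l *m X = (1 - c l) *: (P l *m v).
  apply/colP => k; rewrite Pblock_coord XE [RHS]mxE Pblock_coord.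
  by have := enum_valP k; rewrite Gb => /eqP <-.
apply: Prox_subgradient => y; rewrite !qE.
have -> : u - X = (u - v) + \sum_l (P l)^T *m bproj (r l) (P l *m v).
  by rewrite /X /sgl_prox -/v opprB addrA addrAC.
rewrite dotpDl addrACA; apply: lerD.
  rewrite /varphi /l1norm !mulr_sumr -big_split /=; apply: ler_sum => i _.
  have [c0 c1 _ _] := bproj_ratioP (P (b i) *m v) (r0 (b i)); rewrite -/(c _) in c0 c1.
  rewrite [(u - v) _ _]mxE [(y - X) _ _]mxE [(- v) _ _]mxE [(- X) _ _]mxE XE.
  have [sl ss] := soft_thr_subgrad (u i 0) lam0.
  have -> : v i 0 = soft_thr lam (u i 0) by rewrite mxE.
  rewrite mulrBr mulrCA ss normrM ger0_norm; last by rewrite subr_ge0.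
  rewrite (mulrCA lam) addrC subrK.
  by apply: le_trans (ler_norm _) _; rewrite normrM; exact: ler_wpM2r.
rewrite dotp_suml -big_split /=; apply: ler_sum => l _.
have [c0 c1 cr cd] := bproj_ratioP (P l *m v) (r0 l); rewrite -/(c _) in c0 c1 cr cd.
rewrite dotp_trmx mulmxBr !restrE PX.
have -> : bproj (r l) (P l *m v) = c l *: (P l *m v) by [].
set z := P l *m v in cr cd *; set w := P l *m y.
rewrite enormZ ger0_norm ?subr_ge0 // dotpDr dotpNr dotpZr !dotpZl -sqr_enorm.
have zw := dotp_le z w; have := enorm_ge0 w; have := enorm_ge0 z => z0 w0.
have h1 : c l * dotp z w <= r l * enorm w.
  apply: (@le_trans _ _ (c l * enorm z * enorm w)).
    by rewrite -mulrA ler_wpM2l.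
  by rewrite ler_wpM2r.
have h2 : (1 - c l) * (c l * enorm z ^+ 2) = r l * ((1 - c l) * enorm z).
  by case: cd => [->|<-]; ring.
by rewrite h2 addrC subrK.
Qed.

Definition sgl_mx (t : 'rV[R]_g) (th : 'rV[R]_n) (v : 'cV[R]_n) : 'M[R]_n :=
  (1%:M - \sum_l (P l)^T *m bproj_slope (r l) (t 0 l) (P l *m v) *m P l)
    *m diag_mx th.

Definition sgl_param (u : 'cV[R]_n) (p : 'rV[R]_g * 'rV[R]_n) : Prop :=
  (forall l, switch (r l) (enorm (P l *m soft lam u)) (p.1 0 l)) /\
  (forall i, switch lam `|u i 0| (p.2 0 i)).

End Regularizer.

(** Substituting the two Clarke Jacobians turns the multifunction into a family
    of matrices indexed by the slopes. *)
Lemma sgl_ME (R : realType) n g (lam1 lam2 : R) w (G : 'I_g -> {set 'I_n}) u :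
  0 <= lam1 -> 0 <= lam2 -> (forall l, 0 < w l) ->
  sgl_M lam1 lam2 w G u =
  [set sgl_mx (fun l => lam2 * w l) G p.1 p.2 (soft lam1 u) |
    p in sgl_param lam1 (fun l => lam2 * w l) G u].
Proof.
move=> lam10 lam20 w0.
have r0 l : 0 <= lam2 * w l by rewrite mulr_ge0 // ltW.
have PE m : Prox (varphi lam1) = @soft R lam1 m.
  by apply/funext => x; exact: Prox_varphi.
have BE m l : Defs.proj (ball2 (lam2 * w l)) = @bproj R (lam2 * w l) m.
  by apply/funext => x; exact: proj_ball2.
have ME (S : forall l, 'M[R]_#|G l|) :
    (Pmx G)^T *m (\mxdiag_l S l) *m Pmx G =
    \sum_l (Pblock (G l))^T *m S l *m Pblock (G l).
  rewrite /Pmx tr_mxcol -mulmxA mul_mxdiag_mxcol mul_mxrow_mxcol.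
  by apply: eq_bigr => l _; rewrite mulmxA.
apply/seteqP; split=> [M|_ [[t th] [/= ht hth] <-]].
  case=> Sg; case=> Theta; case=> hS hT ->.
  move: hT; rewrite PE clarke_soft // => /soft_slopesP[th hth ->].
  have {}hS l : exists t, switch (lam2 * w l) (enorm (Pblock (G l) *m soft lam1 u)) t
      /\ Sg l = bproj_slope (lam2 * w l) t (Pblock (G l) *m soft lam1 u).
    have := hS l; rewrite PE BE restrE clarke_bproj // => -[t ? ?].
    by exists t.
  have [t ht] := choice hS.
  exists (\row_l t l, th).
    by split=> //= l; rewrite mxE; have [] := ht l.
  rewrite /sgl_mx ME /=; congr ((_ - _) *m _); apply: eq_bigr => l _.
  by rewrite mxE; have [_ ->] := ht l.
exists (fun l => bproj_slope (lam2 * w l) (t 0 l) (Pblock (G l) *m soft lam1 u)),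
  (diag_mx th); split.
- move=> l; rewrite PE BE restrE clarke_bproj //.
  by exists (t 0 l).
- by rewrite PE clarke_soft //; apply/soft_slopesP; exists th.
- by rewrite ME.
Qed.

(** * Multifunctions with a compact parameter *)

Section ParametrizedMultifunction.
Context (X P Y : topologicalType) (B : set P) (K : X -> set P)
  (Phi : X * P -> Y).
Context (cB : compact B) (cK : closed [set xp | K xp.1 xp.2])
  (KB : forall x, K x `<=` B) (cPhi : continuous Phi).

Lemma compact_param_image x : compact [set Phi (x, p) | p in K x].
Proof.
have cx : continuous (fun p : P => (x, p)).
  by move=> p; apply: cvg_pair => /=; [exact: cvg_cst | exact: cvg_id].
apply: (@continuous_compact _ _ (fun p => Phi (x, p))).
  apply: continuous_subspaceT => p.
  by apply: continuous_comp; [exact: cx | exact: cPhi].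
apply: subclosed_compact cB (@KB x).
by apply: (@preimage_closed _ _ (fun p => (x, p)) _ _ cK) => p _; exact: cx.
Qed.

(** Each parameter p of B has a neighbourhood that, for x' near x, contains
    only non-admissible parameters (if p is not admissible at x) or parameters
    mapped into V. Compactness of B makes the neighbourhood of x uniform. *)
Lemma usc_param_image :
  upper_semicontinuous_mf (fun x => [set Phi (x, p) | p in K x]).
Proof.
move=> x V oV KV.
have cov : forall p, B p -> \forall p' \near p & x' \near x,
    K x' p' -> V (Phi (x', p')).
  move=> p Bp; have [Kp|nKp] := pselect (K x p).
    have VP : nbhs (x, p) (Phi @^-1` V).
      apply: cPhi; apply: open_nbhs_nbhs; split=> //.
      by apply: KV; exists p.
    case: VP => -[/= U W] [xU pW] UW; exists (W, U) => //= -[p' x'] [/= ? ?] _.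
    exact: (UW (x', p')).
  have : nbhs (x, p) (~` [set xp : X * P | K xp.1 xp.2]).
    by apply: open_nbhs_nbhs; split=> //; exact: closed_openC.
  case=> -[/= U W] [xU pW] UW; exists (W, U) => //= -[p' x'] [/= ? ?] Kp'.
  by have := UW (x', p'); case.
have := (compact_near_coveringP B).1 cB _ (nbhs x)
  (fun x' p' => K x' p' -> V (Phi (x', p'))) (nbhs_filter x) cov.
apply: (@filterS _ (nbhs x)) => y BV _ [p Kp <-].
exact: BV (KB Kp) Kp.
Qed.

End ParametrizedMultifunction.

(** * Continuity of the building blocks *)

Section Continuity.
Context {R : realType} (T : topologicalType).

Lemma continuous_mulmx m n p (A : T -> 'M[R]_(m, n)) (B : T -> 'M[R]_(n, p)) :
  continuous A -> continuous B -> continuous (fun x => A x *m B x).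
Proof.
move=> Ac Bc; apply: mx_continuous => i j.
rewrite (_ : (fun _ => _) = fun x => \sum_k A x i k * B x k j); last first.
  by apply/funext => x; rewrite mxE.
by apply: continuous_bigsum => k; apply: continuous_mulr;
  exact: continuous_coord.
Qed.

Lemma continuous_summx m n (I : finType) (A : I -> T -> 'M[R]_(m, n)) :
  (forall i, continuous (A i)) -> continuous (fun x => \sum_i A i x).
Proof.
move=> Ac; apply: mx_continuous => i j.
rewrite (_ : (fun _ => _) = fun x => \sum_k A k x i j); last first.
  by apply/funext => x; rewrite summxE.
by apply: continuous_bigsum => k; exact: continuous_coord.
Qed.

Lemma soft_continuous lam n : continuous (@soft R lam n).
Proof.
apply: mx_continuous => i j.
rewrite (_ : (fun _ => _) = soft_thr lam \o (fun x : 'cV[R]_n => x i 0)); last first.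
  by apply/funext => x; rewrite mxE.
have sc : continuous (soft_thr lam).
  move=> a; apply: (@continuousD _ _ _ (fun a => Num.max (a - lam) 0)
    (fun a => Num.min (a + lam) 0)).
    apply: (@continuous_max _ _ (fun a => a - lam) (cst 0)).
      by apply: continuousB; [exact: cvg_id | exact: cst_continuous].
    exact: cst_continuous.
  apply: (@continuous_min _ _ (fun a => a + lam) (cst 0)).
    by apply: continuousD; [exact: cvg_id | exact: cst_continuous].
  exact: cst_continuous.
move=> x; apply: continuous_comp; [exact: coord_continuous | exact: sc].
Qed.

End Continuity.

(** * The generalized Jacobians and the second-order estimate *)

Section Main.
Context {R : realType} {n g : nat} (lam : R) (r : 'I_g -> R)
  (G : 'I_g -> {set 'I_n}).

Local Notation P l := (@Pblock R n (G l)).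
Local Notation mx := (sgl_mx r G).
Local Notation X := ('cV[R]_n * ('rV[R]_g * 'rV[R]_n))%type.

Lemma sgl_mx_continuous : (forall l, 0 <= r l) ->
  continuous (fun up : X =>
    mx up.2.1 up.2.2 (soft lam up.1)).
Proof.
move=> r0.
have c1 : continuous (fun up : X => up.1).
  by move=> ?; exact: cvg_fst.
have c2 : continuous (fun up : X => up.2).
  by move=> ?; exact: cvg_snd.
have c21 : continuous (fun up : X => up.2.1).
  by move=> up; apply: (continuous_comp (c2 up)); exact: cvg_fst.
have c22 : continuous (fun up : X => up.2.2).
  by move=> up; apply: (continuous_comp (c2 up)); exact: cvg_snd.
have cs : continuous (fun up : X => soft lam up.1).
  by move=> up; apply: (continuous_comp (c1 up)); exact: soft_continuous.
apply: continuous_mulmx.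
  have h : continuous (fun up : X =>
     \sum_l (P l)^T *m bproj_slope (r l) (up.2.1 0 l) (P l *m soft lam up.1) *m P l).
    apply: continuous_summx => l.
    apply: continuous_mulmx; last exact: cst_continuous.
    apply: continuous_mulmx; first exact: cst_continuous.
    apply: bproj_slope_continuous => //.
      exact: continuous_coord.
    apply: continuous_mulmx; first exact: cst_continuous.
    exact: cs.
  move=> up; apply: (continuousB _ (h up)); exact: cst_continuous.
apply: mx_continuous => i j.
rewrite (_ : (fun _ => _) =
  fun up : X => up.2.2 0 i * (i == j)%:R); last first.
  by apply/funext => up; rewrite mxE mulr_natr.
by apply: continuous_mulr; [exact: continuous_coord | exact: cst_continuous].
Qed.

Lemma closed_sgl_param : closed [set up : X |
  sgl_param lam r G up.1 up.2].
Proof.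
have c1 : continuous (fun up : X => up.1).
  by move=> ?; exact: cvg_fst.
have c2 : continuous (fun up : X => up.2).
  by move=> ?; exact: cvg_snd.
have c21 : continuous (fun up : X => up.2.1).
  by move=> up; apply: (continuous_comp (c2 up)); exact: cvg_fst.
have c22 : continuous (fun up : X => up.2.2).
  by move=> up; apply: (continuous_comp (c2 up)); exact: cvg_snd.
have cs : continuous (fun up : X => soft lam up.1).
  by move=> up; apply: (continuous_comp (c1 up)); exact: soft_continuous.
rewrite (_ : [set _ | _] =
  (\bigcap_(l in [set: 'I_g])
    [set up : X |
      switch (r l) (enorm (P l *m soft lam up.1)) (up.2.1 0 l)]) `&`
  (\bigcap_(i in [set: 'I_n])
    [set up : X |
      switch lam `|up.1 i 0| (up.2.2 0 i)])); last first.
  apply/seteqP; split=> up [h1 h2]; split=> k.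
  - by move=> _; exact: h1.
  - by move=> _; exact: h2.
  - exact: (h1 k I).
  - exact: (h2 k I).
apply: closedI; apply: closed_bigI => k _; apply: closed_switch;
  try exact: continuous_coord.
  have cP : continuous (fun up : X =>
      P k *m soft lam up.1).
    by apply: continuous_mulmx; [exact: cst_continuous | exact: cs].
  by move=> up; apply: (continuous_comp (cP up)); exact: enorm_continuous.
have ci := @continuous_coord R _ _ _ _ k 0 c1.
by move=> up; apply: (continuous_comp (ci up)); exact: norm_continuous.
Qed.

Definition unit_box : set ('rV[R]_g * 'rV[R]_n) :=
  [set t : 'rV[R]_g | forall l, `[0, 1]%classic (t ord0 l)] `*`
  [set th : 'rV[R]_n | forall i, `[0, 1]%classic (th ord0 i)].

Lemma compact_unit_box : compact unit_box.
Proof.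
have c01 k := @rV_compact R k (fun=> `[0, 1]%classic) (fun=> @segment_compact R 0 1).
exact: compact_setX (c01 g) (c01 n).
Qed.

Lemma sgl_param_box u : sgl_param lam r G u `<=` unit_box.
Proof.
move=> [t th] [/= ht hth]; split=> /= [l|i]; rewrite in_itv /=.
  by case/and4P: (ht l).
by case/and4P: (hth i).
Qed.

Lemma sgl_param_nonempty u : sgl_param lam r G u !=set0.
Proof.
have [t ht] := choice (fun l => switch_ex (r l) (enorm_ge0 (P l *m soft lam u))).
have [th hth] := choice (fun i => switch_ex lam (normr_ge0 (u i 0))).
by exists (\row_l t l, \row_i th i); split=> /= k; rewrite mxE.
Qed.

(** On the group G_l the ball derivative is c_l (1 - t_l / m_l^2 v v^T). In the
    product with Theta the dyad survives unchanged, since Theta fixes the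
    coordinates where v is nonzero, and the rest is diagonal. *)
Lemma sgl_mx_decomposition (b : 'I_n -> 'I_g) t th u :
  0 <= lam -> (forall l, 0 <= r l) -> (forall i l, (i \in G l) = (l == b i)) ->
  sgl_param lam r G u (t, th) ->
  exists (d : 'rV[R]_n) (k : 'I_g -> R) (z : 'I_g -> 'cV[R]_n),
  [/\ forall i, 0 <= d 0 i, forall l, 0 <= k l &
    mx t th (soft lam u) = diag_mx d + \sum_l k l *: (z l *m (z l)^T)].
Proof.
move=> lam0 r0 Gb [/= ht hth]; set v := soft lam u.
pose c l := bproj_ratio (r l) (P l *m v).
pose m l := Num.max (r l) (enorm (P l *m v)).
pose z l := (P l)^T *m (P l *m v).
have zth l : (z l)^T *m diag_mx th = (z l)^T.
  apply/rowP => i; rewrite mul_mx_diag [LHS]mxE.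
  rewrite (_ : (z l)^T 0 i = (i \in G l)%:R * v i 0); last first.
    by rewrite mxE /z mulmxA tr_mul_Pblock mul_diag_mx !mxE.
  rewrite -mulrA [v i 0]mxE; congr (_ * _); rewrite mulrC.
  exact: switch_mul_soft_thr.
have c01 l : 0 <= c l <= 1.
  by have [c0 c1 _ _] := bproj_ratioP (P l *m v) (r0 l); rewrite c0 c1.
exists (\row_i ((1 - c (b i)) * th 0 i)), (fun l => c l * (t 0 l / m l ^+ 2)), z.
split=> [i|l|].
- rewrite mxE mulr_ge0 //; first by case/andP: (c01 (b i)); lra.
  by case/and4P: (hth i) => /andP[].
- apply: mulr_ge0; first by case/andP: (c01 l).
  by rewrite divr_ge0 ?sqr_ge0 //; case/and4P: (ht l) => /andP[].
have E l : (P l)^T *m bproj_slope (r l) (t 0 l) (P l *m v) *m P l *m diag_mx th =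
    c l *: (diag_mx (\row_i (i \in G l)%:R) *m diag_mx th) -
    (c l * (t 0 l / m l ^+ 2)) *: (z l *m (z l)^T).
  rewrite /bproj_slope -/(m l) -/(bproj_ratio _ _) -/(c l).
  rewrite -scalemxAr -!scalemxAl mulmxBr.
  rewrite mulmx1 !mulmxBl tr_mul_Pblock -scalemxAr -!scalemxAl scalerBr scalerA.
  congr (_ - _ *: _); rewrite -(zth l) /z [(_ *m (P l *m v))^T]trmx_mul trmxK.
  by rewrite !mulmxA.
rewrite /sgl_mx mulmxBl mul1mx mulmx_suml (eq_bigr _ (fun l _ => E l)) sumrB.
rewrite opprB addrCA addrC; congr (_ + _).
apply/matrixP => i j; rewrite !mxE summxE (bigD1 (b i)) //= big1 ?addr0.
  rewrite mxE mul_diag_mx !mxE Gb eqxx mul1r.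
  by case: eqVneq => _; rewrite ?mulr1n ?mulr0n; ring.
move=> l lb; rewrite mxE mul_diag_mx !mxE Gb (negbTE lb) mul0r mulr0 //.
Qed.

Lemma diag_plus_gram_symmetric_psd (d : 'rV[R]_n) (k : 'I_g -> R)
    (z : 'I_g -> 'cV[R]_n) :
  (forall i, 0 <= d 0 i) -> (forall l, 0 <= k l) ->
  let M := diag_mx d + \sum_l k l *: (z l *m (z l)^T) in
  M^T = M /\ possemidef M.
Proof.
move=> d0 k0 M; split.
  rewrite /M linearD /= tr_diag_mx linear_sum /=; congr (_ + _).
  by apply: eq_bigr => l _; rewrite linearZ /= trmx_mul trmxK.
move=> x; rewrite -mulmxA -dotpE /M mulmxDl mulmx_suml dotpDr.
apply: addr_ge0.
  apply: sumr_ge0 => i _; rewrite mul_diag_mx !mxE mulrCA mulr_ge0 //.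
  by rewrite -expr2 sqr_ge0.
rewrite dotpC dotp_suml; apply: sumr_ge0 => l _.
rewrite -scalemxAl dotpZl mulr_ge0 // -mulmxA.
rewrite -{1}[z l]trmxK dotp_trmx; exact: dotpxx_ge0.
Qed.

(** Since soft x - soft u = Theta (x - u), the error is, up to sign, the sum
    over the groups of the projection errors between P_l soft u and
    P_l soft x; soft is nonexpansive here because Theta has entries in
    [0, 1]. The summand 1 only makes the constant positive. *)
Lemma sgl_estimate (u : 'cV[R]_n) : 0 <= lam -> (forall l, 0 <= r l) ->
  exists2 C, 0 < C & \forall x \near u, forall t th,
    sgl_param lam r G x (t, th) ->
    enorm (sgl_prox lam r G x - sgl_prox lam r G u -
      mx t th (soft lam x) *m (x - u)) <= C * enorm (x - u) ^+ 2.
Proof.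
move=> lam0 r0.
exists (1 + \sum_l 4 / r l).
  by rewrite ltr_pwDl // sumr_ge0 // => l _; rewrite divr_ge0.
have sn := soft_near u lam0.
have bn : \forall x \near u, forall l, forall t,
    switch (r l) (enorm (P l *m soft lam x)) t ->
    enorm (bproj (r l) (P l *m soft lam x) - bproj (r l) (P l *m soft lam u) -
      bproj_slope (r l) t (P l *m soft lam x) *m
        (P l *m soft lam x - P l *m soft lam u))
    <= 4 / r l * enorm (P l *m soft lam x - P l *m soft lam u) ^+ 2.
  apply: (@filter_forall _ _ _ (nbhs u)) => l.
  have cP : continuous (fun x : 'cV[R]_n => P l *m soft lam x).
    by apply: continuous_mulmx; [exact: cst_continuous | exact: soft_continuous].
  exact: cP _ (bproj_near (P l *m soft lam u) (r0 l)).
apply: filterS2 sn bn => x sx bx t th [/= ht hth].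
have {}sx := sx th hth.
set a := soft lam x in sx bx ht *; set c := soft lam u in sx bx *.
have ac : enorm (a - c) <= enorm (x - u).
  rewrite -(@ler_pXn2r _ 2) ?nnegrE ?enorm_ge0 // sx !sqr_enorm.
  apply: ler_sum => i _; rewrite mul_diag_mx !mxE.
  case/and4P: (hth i) => /andP[t0 t1] _ _ _.
  rewrite -!expr2 exprMn ler_piMl ?sqr_ge0 // exprn_ile1 //.
have -> : sgl_prox lam r G x - sgl_prox lam r G u - mx t th a *m (x - u) =
    - \sum_l (P l)^T *m (bproj (r l) (P l *m a) - bproj (r l) (P l *m c) -
      bproj_slope (r l) (t 0 l) (P l *m a) *m (P l *m a - P l *m c)).
  rewrite /sgl_mx -mulmxA -sx mulmxBl mul1mx mulmx_suml /sgl_prox -/a -/c.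
  rewrite [in RHS](eq_bigr (fun l => (P l)^T *m bproj (r l) (P l *m a) -
    (P l)^T *m bproj (r l) (P l *m c) -
    (P l)^T *m bproj_slope (r l) (t 0 l) (P l *m a) *m P l *m (a - c))); last first.
    by move=> l _; rewrite -mulmxBr !mulmxBr !mulmxA.
  rewrite !sumrB; move: (\sum_l _) (\sum_l _) (\sum_l _) => S1 S2 S3.
  by apply/colP => i; rewrite !mxE; ring.
rewrite enormN; apply: le_trans (enorm_sum _) _.
rewrite mulrDl mulr_suml; apply: ler_wpDl; first by rewrite mul1r sqr_ge0.
apply: ler_sum => l _; rewrite enorm_trPblock.
apply: le_trans (bx l _ (ht l)) _; rewrite ler_wpM2l ?divr_ge0 //.
rewrite ler_pXn2r ?nnegrE ?enorm_ge0 // -mulmxBr.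
exact: le_trans (enorm_Pblock _ _) ac.
Qed.

End Main.

Theorem theorem3p1 (R : realType) (n g : nat) (lambda1 lambda2 : R)
    (w : 'I_g -> R) (G : 'I_g -> {set 'I_n})
    (lambda1_ge0 : 0 <= lambda1) (lambda2_ge0 : 0 <= lambda2)
    (w_gt0 : forall l, 0 < w l) (partG : is_partition G) (u : 'cV[R]_n) :
  let p := sgl_reg lambda1 lambda2 w G in
  let calM := sgl_M lambda1 lambda2 w G in
  [/\ forall x, calM x !=set0,
      forall x, compact (calM x),
      upper_semicontinuous_mf calM,
      forall M, calM u M -> M^T = M /\ possemidef M &
      exists C eps : R, [/\ 0 < C, 0 < eps &
        forall x : 'cV[R]_n, enorm (x - u) <= eps ->
        forall M, calM x M ->
          enorm (Prox p x - Prox p u - M *m (x - u)) <= C * enorm (x - u) ^+ 2]].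
Proof.
move=> p calM; pose r l := lambda2 * w l.
have r0 l : 0 <= r l by rewrite mulr_ge0 // ltW.
have [b Gb] := partition_label partG.
have proxE x : Prox p x = sgl_prox lambda1 r G x by exact: (Prox_sgl _ _ _ Gb).
pose Phi (xp : 'cV[R]_n * ('rV[R]_g * 'rV[R]_n)) :=
  sgl_mx r G xp.2.1 xp.2.2 (soft lambda1 xp.1).
have calME : calM = fun x => [set Phi (x, p) | p in sgl_param lambda1 r G x].
  by apply/funext => x; exact: sgl_ME.
have cPhi : continuous Phi by exact: sgl_mx_continuous.
have cK := @closed_sgl_param R n g lambda1 r G.
have cB := @compact_unit_box R n g.
have KB x := @sgl_param_box R n g lambda1 r G x.
rewrite calME; split.
- move=> x; have [q xq] := sgl_param_nonempty lambda1 r G x.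
  by exists (Phi (x, q)); exists q.
- by move=> x; exact: (compact_param_image cB cK KB cPhi).
- exact: (usc_param_image cB cK KB cPhi).
- move=> _ [[t th] uq <-]; rewrite /Phi /=.
  have [d [k [z [d0 k0 ->]]]] := sgl_mx_decomposition lambda1_ge0 r0 Gb uq.
  exact: diag_plus_gram_symmetric_psd.
- have [C C0 nearC] := sgl_estimate G u lambda1_ge0 r0.
  have [e e0 eC] := near_enorm nearC.
  exists C, e; split=> // x xu _ [[t th] xq <-].
  by rewrite !proxE; exact: eC xu _ _ xq.
Qed.
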